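(* Taking suprema over all edge probability measures $\mu$ (on all finite complete graphs), \begin{align*} \sup_{\mu}\Bigl(2\sum_{e\in\operatorname{supp}\mu}\mu(e)^2+\beta(\mu;P_3)\Bigr) &= 2,\\ \sup_{\mu}\bigl(2m\cdot\beta(\mu;C_m)+\beta(\mu;P_{m+1})\bigr) &= \frac{2}{m^{m-1}}\quad\text{for } m\in\{3,4\},\\ \sup_{\mu}\bigl(2m\cdot\beta(\mu;C_m)+\beta(\mu;P_{m+1})\bigr) &< \frac{2.7}{m^{m-1}}\quad\text{for all integers } m\ge 5. \end{align*}
   Context: $C_k$ is the cycle on $k$ vertices and $P_k$ is the path on $k$ vertices. An edge probability measure is a probability measure $\mu$ on the edge set $E(K)$ of some finite complete graph $K$; $\operatorname{supp}\mu$ is the set of edges of positive mass. For a subgraph $H'\subseteq K$, $\mu(H')=\prod_{e\in E(H')}\mu(e)$, and for a graph $H$, $\beta(\mu;H)=\sum_{H'}\mu(H')$, the sum over all (unlabeled, not necessarily induced) subgraphs $H'$ of $K$ isomorphic to $H$. *)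

(* Defs.v *)
From HB Require Import structures.
From mathcomp Require Import all_boot all_order all_algebra.
From mathcomp Require Import reals.
Set Implicit Arguments. Unset Strict Implicit. Unset Printing Implicit Defensive.
Import Order.TTheory GRing.Theory Num.Theory.
Local Open Scope ring_scope.

Definition Kedges (n : nat) : {set {set 'I_n}} := [set e : {set 'I_n} | #|e| == 2%N].

(* A finite simple graph H given by its number h of vertices and its edge set. *)
Definition P_edges (k : nat) : {set {set 'I_k}} :=
  [set e : {set 'I_k} | [exists i : 'I_k, exists j : 'I_k, (e == [set i; j]) && (val j == (val i).+1)]].
(* The cycle C_k: vertices 0..k-1, edges {i, i+1 mod k} (used for k >= 3). *)
Definition C_edges (k : nat) : {set {set 'I_k}} :=
  [set e : {set 'I_k} | [exists i : 'I_k, exists j : 'I_k,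
     (e == [set i; j]) && (val j == ((val i).+1 %% k)%N)]].

Section EPM.
Variable R : realType.

Definition is_epm (n : nat) (mu : {ffun {set 'I_n} -> R}) : Prop :=
  [/\ forall e, 0 <= mu e,
      forall e, e \notin Kedges n -> mu e = 0
    & \sum_(e in Kedges n) mu e = 1].

Definition iso_sub (n h : nat) (EH : {set {set 'I_h}})
    (VF : {set 'I_n} * {set {set 'I_n}}) : bool :=
  [exists f : {ffun 'I_h -> 'I_n},
    [&& injectiveb f, VF.1 == f @: [set: 'I_h]
      & VF.2 == [set f @: e | e : {set 'I_h} in EH]]].

Definition mu_sub (n : nat) (mu : {ffun {set 'I_n} -> R}) (F : {set {set 'I_n}}) : R :=
  \prod_(e in F) mu e.

Definition beta (n : nat) (mu : {ffun {set 'I_n} -> R}) (h : nat)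
    (EH : {set {set 'I_h}}) : R :=
  \sum_(VF : {set 'I_n} * {set {set 'I_n}} | iso_sub EH VF) mu_sub mu VF.2.

Definition is_sup (S : R -> Prop) (s : R) : Prop :=
  (forall x, S x -> x <= s) /\ (forall eps, 0 < eps -> exists2 x, S x & s - eps < x).

End EPM.

(* Main.v *)
(** Write [M x y] for the mass of the edge [xy].  Twice the quantity to be bounded
    is at most a sum over walks with [m] edges whose first [m] vertices are
    distinct and whose last vertex is either new (coefficient 1) or equal to the
    first one (coefficient 2).

    When such a walk is explored step by step, the edges available at the
    successive vertices form pairwise disjoint sets, so AM-GM bounds the sum over
    all continuations by a power of the mass not yet explored.  At a maximiser,
    which exists by compactness, lowering the mass of an edge [uv] and rescaling
    cannot increase the sum; hence [m] times its value is at most the normalised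
    weight of all walks through [uv], each of which consists of two arms leaving
    [u] and [v].  For an edge [uv] of largest mass [p], bounding the closing edge
    by [p] gives [(m-1)^-(m-1)], about [e / m^(m-1)].

    For [m = 3] and [m = 4] the sum over pairs of arms is estimated explicitly.
    For large [m] the constant drops below [2.7]: if [m p >= 0.6] the closing edge
    is too heavy for equality in AM-GM; otherwise, if every vertex [x] has degree
    at least [2 r + 0.02 / m], where [r] is the mass of its heaviest edge, exploring
    from the first vertex of the walk saves a factor; and at a vertex violating
    this, too little mass lies outside the heaviest edge for that edge to satisfy
    the optimality condition. *)
Require Import Defs.
From HB Require Import structures.
From mathcomp Require Import all_boot all_order all_algebra.
From mathcomp Require Import reals.
From mathcomp Require Import boolp classical_sets topology.
From mathcomp Require Import normedtype sequences derive exp.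
From mathcomp Require Import lra ring zify.
Set Implicit Arguments. Unset Strict Implicit. Unset Printing Implicit Defensive.
Import Order.TTheory GRing.Theory Num.Theory.
Local Open Scope ring_scope.

(** * Sums over walks *)

Section ListSums.
Variables (R : realFieldType) (T : finType).
Implicit Types (F G : seq T -> R) (s : seq T).

(** Walks are plain vertex lists summed one vertex at a time, so splitting off the first step is a
    computation. *)
Fixpoint sumw (k : nat) (F : seq T -> R) : R :=
  if k is k'.+1 then \sum_x sumw k' (fun s => F (x :: s)) else F [::].

Lemma sumwS k F : sumw k.+1 F = \sum_x sumw k (fun s => F (x :: s)).
Proof. by []. Qed.

Lemma eq_sumw k F G : (forall s, size s = k -> F s = G s) -> sumw k F = sumw k G.
Proof.
elim: k F G => [|k IH] F G FG /=; first exact: FG.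
by apply: eq_bigr => x _; apply: IH => s sk; apply: FG; rewrite /= sk.
Qed.

Lemma le_sumw k F G : (forall s, size s = k -> F s <= G s) -> sumw k F <= sumw k G.
Proof.
elim: k F G => [|k IH] F G FG /=; first exact: FG.
by apply: ler_sum => x _; apply: IH => s sk; apply: FG; rewrite /= sk.
Qed.

Lemma sumw0 k : sumw k (fun=> 0) = 0.
Proof. by elim: k => //= k IH; rewrite big1. Qed.

Lemma sumw_ge0 k F : (forall s, 0 <= F s) -> 0 <= sumw k F.
Proof. by move=> F0; rewrite -(sumw0 k); apply: le_sumw. Qed.

Lemma sumw_sum (I : Type) (r : seq I) (P : pred I) k (F : I -> seq T -> R) :
  sumw k (fun s => \sum_(i <- r | P i) F i s) = \sum_(i <- r | P i) sumw k (F i).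
Proof.
elim: k F => [//|k IH] F /=; rewrite exchange_big /=.
by apply: eq_bigr => x _; rewrite IH.
Qed.

Lemma sumwD k F G : sumw k (fun s => F s + G s) = sumw k F + sumw k G.
Proof.
elim: k F G => [//|k IH] F G /=; rewrite -big_split.
by apply: eq_bigr => x _; rewrite IH.
Qed.

Lemma sumwZ k c F : sumw k (fun s => c * F s) = c * sumw k F.
Proof.
elim: k F => [//|k IH] F /=; rewrite mulr_sumr.
by apply: eq_bigr => x _; rewrite IH.
Qed.

Lemma sumw_exchange k l (F : seq T -> seq T -> R) :
  sumw k (fun s => sumw l (F s)) = sumw l (fun t => sumw k (F^~ t)).
Proof.
elim: k F => [//|k IH] F /=; rewrite sumw_sum.
by apply: eq_bigr => x _; rewrite IH.
Qed.

Lemma sumw_rcons k F : sumw k.+1 F = \sum_x sumw k (fun s => F (rcons s x)).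
Proof.
elim: k F => [//|k IH] F; rewrite [LHS]/=.
under eq_bigr => x _ do rewrite -/(sumw k.+1 (fun s => F (x :: s))) IH.
rewrite exchange_big /=; apply: eq_bigr => y _; exact: eq_bigr.
Qed.

Fixpoint count_step (u v : T) s : nat :=
  if s is x :: s' then
    ((if s' is y :: _ then (x == u) && (y == v) else false) + count_step u v s')%N
  else 0%N.

(** Weighting by the count means marking one step from [u] to [v]. The walk is cut at the mark, and
    the part before it is listed backwards, as an arm leaving [u]. *)
Lemma sumw_count_step k u v F :
  sumw k.+2 (fun s => F s * (count_step u v s)%:R) =
  \sum_(i < k.+1) sumw i (fun ys => sumw (k - i) (fun zs => F (rev ys ++ u :: v :: zs))).
Proof.
elim: k F => [|k IH] F.
  rewrite big_ord_recl big_ord0 addr0 /= (bigD1 u) //= (bigD1 v) //= !eqxx /=.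
  rewrite mulr1 !big1 ?addr0 // => [x xu|y yv].
    by rewrite big1 // => y _; rewrite (negPf xu) mulr0.
  by rewrite (negPf yv) mulr0.
have -> : sumw k.+3 (fun s => F s * (count_step u v s)%:R) =
   sumw k.+3 (fun s => (if s is x :: y :: _ then if (x == u) && (y == v) then F s else 0
     else 0))
   + \sum_x sumw k.+2 (fun s => F (x :: s) * (count_step u v s)%:R).
  rewrite -[X in _ + X]/(sumw k.+3 (fun s => F s * (count_step u v (behead s))%:R))
    -sumwD.
  apply: eq_sumw => -[|x [|y s]] //= _; rewrite natrD mulrDr.
  by case: ifP; rewrite ?mulr1 ?mulr0.
rewrite big_ord_recl; congr (_ + _).
  rewrite subn0 /= (bigD1 u) //= (bigD1 v) //= !eqxx /=.
  rewrite [X in _ + X]big1 ?addr0; last first.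
    move=> x xu; rewrite big1 // => y _; rewrite (negPf xu); apply: big1 => z _.
    exact: sumw0.
  rewrite [X in _ + X]big1 ?addr0 // => y yv; rewrite (negPf yv); apply: big1 => z _.
  exact: sumw0.
under eq_bigr => x _ do rewrite (IH (fun s => F (x :: s))).
rewrite exchange_big; apply: eq_bigr => i _ /=.
rewrite -/(sumw i.+1 (fun s => _)).
rewrite -[RHS]/(sumw i.+1 (fun ys => sumw (k.+1 - bump 0 i) (fun zs => F (rev ys ++ [::
  u, v & zs])))).
rewrite sumw_rcons; apply: eq_bigr => x _; apply: eq_sumw => ys _.
by rewrite rev_rcons /bump add1n subSS.
Qed.

End ListSums.

(** * Weights of walks and the exploration bounds *)

Section Arms.
Variables (R : realFieldType) (T : finType) (M : T -> T -> R).
Hypothesis M_ge0 : forall x y, 0 <= M x y.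
Hypothesis M_sym : forall x y, M x y = M y x.
Hypothesis M_diag : forall x, M x x = 0.
Implicit Types (s X : seq T).

(** The mass of the edges with no end in [X]; the factor 1/2 corrects for the two orders of the
    ends. *)
Definition rest_mass X : R := 2^-1 * \sum_(x | x \notin X) \sum_(y | y \notin X) M x y.

Lemma rest_mass_ge0 X : 0 <= rest_mass X.
Proof. by rewrite mulr_ge0 // ?invr_ge0 // !sumr_ge0 // => x _; rewrite sumr_ge0. Qed.

Lemma rest_massE v X : v \notin X ->
  rest_mass X = rest_mass (v :: X) + \sum_(y | y \notin v :: X) M v y.
Proof.
move=> vX; pose S := \sum_(y | y \notin v :: X) M v y.
have D (f : T -> R) : \sum_(y | y \notin X) f y = f v + \sum_(y | y \notin v :: X) f y.
  rewrite (bigD1 v) //=; congr (_ + _).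
  by apply: eq_bigl => y; rewrite inE negb_or andbC.
rewrite /rest_mass (D (fun x => _)) D M_diag add0r -/S.
under eq_bigr => x _ do rewrite D.
rewrite big_split /= (eq_bigr _ (fun x _ => M_sym x v)) -/S.
by field.
Qed.

Lemma step_le_rest_mass v X : v \notin X -> \sum_(y | y \notin v :: X) M v y <= rest_mass
  X.
Proof. by move=> /rest_massE ->; rewrite lerDr rest_mass_ge0. Qed.

(** AM-GM for one term [a] and [k] terms [b / k]; for [k = 0] it degenerates to [a <= a + b]. *)
Lemma amgm k (a b : R) : 0 <= a -> 0 <= b ->
  a * (b / k%:R) ^+ k <= ((a + b) / k.+1%:R) ^+ k.+1.
Proof.
case: k => [|k] a0 b0; first by rewrite expr0 expr1 mulr1 divr1 lerDl.
set c := b / _.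
have := (leif_AGM (A := [set: 'I_k.+2]) (E := fun i : 'I_k.+2 => if i == ord0 then a else
  c)).
have c0 : 0 <= c by rewrite divr_ge0.
rewrite cardsT card_ord (eq_bigl xpredT) => [|i]; last by rewrite inE.
rewrite (eq_bigl xpredT (fun i => if i == ord0 then a else c)) => [|i];
  last by rewrite inE.
rewrite !big_ord_recl /= prodr_const sumr_const card_ord => H.
have -> : a + b = a + c *+ k.+1.
  by rewrite -mulr_natr /c mulfVK // pnatr_eq0.
by rewrite exprS mulrS; apply: (fst (H _)) => i _; case: ifP.
Qed.

Fixpoint pw x s : R := if s is y :: s' then M x y * pw y s' else 1.

Lemma pw_ge0 x s : 0 <= pw x s.
Proof. by elim: s x => [|y s IH] x //=; rewrite mulr_ge0. Qed.

Lemma pw_cat x s t : pw x (s ++ t) = pw x s * pw (last x s) t.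
Proof. by elim: s x => [|y s IH] x /=; rewrite ?mul1r // IH mulrA. Qed.

Lemma pw_rcons x s y : pw x (rcons s y) = pw x s * M (last x s) y.
Proof. by rewrite -cats1 pw_cat /= mulr1. Qed.

(* Each step of the walk uses up edges at its current vertex, so the successive
   sums run over disjoint edge sets and AM-GM applies to the masses of these sets. *)
Lemma arm_bound k v X j (q c : R) (C : seq T -> R) : 0 <= q -> 0 <= c ->
  v \notin X ->
  (forall s, size s = k -> uniq (v :: s) -> ~~ has (mem X) s ->
     C s <= c * ((rest_mass (catrev (belast v s) X) + q) / j%:R) ^+ j) ->
  sumw k (fun s => if uniq (v :: s) && ~~ has (mem X) s then pw v s * C s else 0)
    <= c * ((rest_mass X + q) / (j + k)%:R) ^+ (j + k).
Proof.
move=> q0 c0; elim: k v X C => [|k IH] v X C vX HC.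
  by rewrite /= mul1r addn0 HC.
rewrite /=.
have avoidE y s : y \notin v :: X ->
    uniq [:: v, y & s] && ~~ has (mem X) (y :: s)
    = uniq (y :: s) && ~~ has (mem (v :: X)) s.
  rewrite inE negb_or => /andP[yv yX].
  have -> : has (mem (v :: X)) s = (v \in s) || has (mem X) s.
    by rewrite -has_pred1 -has_predU; apply: eq_has => z; rewrite /= inE.
  by rewrite /= inE eq_sym (negPf yv) (negPf yX) /= negb_or; do !case: (_ \in _);
    rewrite ?andbF.
have step y : y \notin v :: X ->
    sumw k (fun s => if uniq (v :: y :: s) && ~~ has (mem X) (y :: s)
                     then pw v (y :: s) * C (y :: s) else 0)
    <= M v y * (c * ((rest_mass (v :: X) + q) / (j + k)%:R) ^+ (j + k)).
  move=> yvX.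
  have -> : sumw k (fun s => if uniq (v :: y :: s) && ~~ has (mem X) (y :: s)
      then pw v (y :: s) * C (y :: s) else 0) = M v y * sumw k (fun s =>
      if uniq (y :: s) && ~~ has (mem (v :: X)) s then pw y s * C (y :: s) else 0).
    rewrite -sumwZ; apply: eq_sumw => s _; rewrite avoidE //.
    by case: ifP; rewrite ?mulr0 //= mulrA.
  apply: ler_wpM2l => //; apply: IH => // s sk us hs.
  have /andP[uvs hX] : uniq [:: v, y & s] && ~~ has (mem X) (y :: s).
    by rewrite avoidE // us.
  by apply: HC; rewrite //= sk.
apply: (@le_trans _ _ (\sum_(y | y \notin v :: X)
    M v y * (c * ((rest_mass (v :: X) + q) / (j + k)%:R) ^+ (j + k)))).
  rewrite (bigID (fun y => y \notin v :: X)) /= [X in _ + X]big1 ?addr0.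
    by apply: ler_sum => y; apply: step.
  move=> y; rewrite negbK => yvX; rewrite -[RHS](sumw0 R T k); apply: eq_sumw => s _.
  rewrite inE in yvX; rewrite inE negb_or; case/orP: yvX => [/eqP->|yX].
    by rewrite eqxx.
  by rewrite /= yX /= andbF.
(* [rest_massE] isolates the mass spent at [v]; AM-GM absorbs it as one more factor. *)
rewrite -mulr_suml mulrCA ler_wpM2l // (rest_massE vX) addrAC addnS addrC.
by apply: amgm; rewrite ?sumr_ge0 // addr_ge0 // rest_mass_ge0.
Qed.

(** The coefficient 2 balances multiplicities: a cycle on [m] vertices is traced by [2m] closed
    walks and a path by two walks, so closed walks need an extra factor 2 to give twice the quantity
    to be bounded. *)
Definition chi s : R :=
  if s is x :: s' then
    if uniq s then 1 else if uniq s' && (last x s' == x) then 2 else 0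
  else 1.

Lemma chi_ge0 s : 0 <= chi s.
Proof. by case: s => //= x s; do !case: ifP. Qed.

Lemma chi_rcons x s y : chi (rcons (x :: s) y) =
  if uniq (x :: s) then if y == x then 2 else (y \notin x :: s)%:R else 0.
Proof.
rewrite /= last_rcons mem_rcons rcons_uniq !inE [x == y]eq_sym.
by case: eqP => [->|_] /=; do !case: (_ \in _); do !case: (uniq _).
Qed.

(** Only the last vertex may repeat an earlier one. *)
Lemma chi_prefix s z s' : ~~ uniq s -> chi (s ++ z :: s') = 0.
Proof.
case: s => [//|x s] us; have [s1 [y sE]] : exists s1 y, z :: s' = rcons s1 y.
  by exists (belast z s'), (last z s'); rewrite lastI.
rewrite sE -rcons_cat [_ ++ _]/= chi_rcons -cat_cons cat_uniq (negPf us) /=.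
by [].
Qed.

Lemma chi_rev s : chi (rev s) = chi s.
Proof.
case: s => // x s; case: (lastP s) => // {}s y.
rewrite rev_cons rev_rcons -rcons_cons chi_rcons [RHS]chi_rcons.
rewrite /= !mem_rev !inE rev_uniq [x == y]eq_sym.
case: eqP => [-> //|_] /=.
by rewrite mem_rev; do !case: (_ \in _); do !case: (uniq _).
Qed.

Definition pwl s : R := if s is x :: s' then pw x s' else 1.

Lemma pwl_cat_rev ys x zs : pwl (rev ys ++ x :: zs) = pw x ys * pw x zs.
Proof.
elim: ys x zs => [|y ys IH] x zs; first by rewrite /= mul1r.
by rewrite rev_cons cat_rcons IH /= (M_sym y x); ring.
Qed.

Definition walk_sum m : R := sumw m.+1 (fun s => chi s * pwl s).

(** The factor [M u v] of the marked edge is left out. The walk starts at the far end of the arm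
    [ys] and ends at the far end of [zs]. *)
Definition two_arms u v i l : R :=
  sumw i (fun ys => sumw l (fun zs => chi (rev ys ++ u :: v :: zs) * (pw u ys * pw v
    zs))).

(** Reversing the walk exchanges the arms and preserves [chi]. *)
Lemma two_armsC u v i l : two_arms v u i l = two_arms u v l i.
Proof.
rewrite /two_arms sumw_exchange; apply: eq_sumw => zs _; apply: eq_sumw => ys _.
rewrite -chi_rev rev_cat !rev_cons revK !cat_rcons [pw v _ * _]mulrC.
by [].
Qed.

Lemma sumw_count_arms u v k :
  sumw k.+2 (fun s => chi s * pwl s * (count_step u v s)%:R) =
  M u v * \sum_(i < k.+1) two_arms u v i (k - i).
Proof.
rewrite sumw_count_step mulr_sumr; apply: eq_bigr => i _.
rewrite -sumwZ; apply: eq_sumw => ys _; rewrite -sumwZ; apply: eq_sumw => zs _.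
by rewrite pwl_cat_rev /=; ring.
Qed.

Lemma sum_two_armsC u v k :
  \sum_(i < k.+1) two_arms v u i (k - i) = \sum_(i < k.+1) two_arms u v i (k - i).
Proof.
rewrite (reindex_inj rev_ord_inj) /=; apply: eq_bigr => i _.
by rewrite subSS subKn -1?ltnS // two_armsC.
Qed.

(* The final step of a walk may close it up at its first vertex [t]; the argument
   [e] records whether [t] still belongs to the available vertices. *)
Lemma closed_arm_bound t e P D v l (c q : R) : 0 <= q -> 0 <= c ->
  (forall s z X, uniq (t :: s) -> perm_eq (e ++ z :: X) (t :: s) ->
     \sum_y chi (rcons (t :: s) y) * M z y <= c * (rest_mass X + q)) ->
  perm_eq (e ++ D) (t :: P) ->
  sumw l.+1 (fun zs => chi (t :: P ++ v :: zs) * pw v zs)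
    <= c * ((rest_mass D + q) / l.+1%:R) ^+ l.+1.
Proof.
move=> q0 c0 Hlast PD.
(* If the prefix up to [v] already repeats a vertex, every term vanishes, because at least one more
   vertex follows [v]. *)
have [tPv|tPv] := boolP (uniq (v :: t :: P)); last first.
  rewrite (eq_sumw (G := fun=> 0)) => [|[//|z zs] _]; last first.
    rewrite -cat_cons -cat_rcons chi_prefix ?mul0r // rcons_uniq.
    by rewrite cons_uniq in tPv.
  by rewrite sumw0 mulr_ge0 // exprn_ge0 // divr_ge0 // addr_ge0 // rest_mass_ge0.
have memD x : x \in D -> x \in t :: P.
  by move=> xD; rewrite -(perm_mem PD) mem_cat xD orbT.
have vD : v \notin D.
  by move: tPv; rewrite cons_uniq => /andP[+ _]; apply: contra => /memD.
pose C zs := \sum_y chi (t :: P ++ v :: rcons zs y) * M (last v zs) y.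
have -> : sumw l.+1 (fun zs => chi (t :: P ++ v :: zs) * pw v zs) =
    sumw l (fun zs => if uniq (v :: zs) && ~~ has (mem D) zs then pw v zs * C zs else 0).
  rewrite sumw_rcons -sumw_sum; apply: eq_sumw => zs _.
  case: ifPn => [_|nu].
    by rewrite mulr_sumr; apply: eq_bigr => y _; rewrite pw_rcons; ring.
  rewrite big1 // => y _;
    rewrite -rcons_cons -rcons_cat -rcons_cons -cats1 chi_prefix ?mul0r //.
  apply: contra nu; rewrite -cat_cons cat_uniq => /and3P[_ hP ->] /=.
  apply: contra hP => /hasP[x xz xD]; apply/hasP; exists x; last exact: memD.
  by rewrite inE xz orbT.
rewrite -[l.+1]add1n; apply: arm_bound => // zs szs uzs hzs.
(* The vertices left behind, the current vertex and [e] together make up the whole walk so far. *)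
have PE : perm_eq (e ++ last v zs :: catrev (belast v zs) D) (t :: P ++ v :: zs).
  rewrite catrevE -cat_cons -rev_rcons -lastI perm_catCA.
  rewrite -cat_cons perm_sym perm_catC; apply: perm_cat; last by rewrite perm_sym.
  by rewrite perm_sym perm_rev.
have -> : C zs = \sum_y chi (rcons (t :: P ++ v :: zs) y) * M (last v zs) y.
  by apply: eq_bigr => y _; rewrite rcons_cons rcons_cat rcons_cons.
rewrite divr1 expr1; have [us|us] := boolP (uniq (t :: P ++ v :: zs)); first exact: Hlast.
rewrite big1 => [|y _]; last by rewrite -cats1 chi_prefix ?mul0r.
by rewrite mulr_ge0 // addr_ge0 // rest_mass_ge0.
Qed.

Definition deg x : R := \sum_y M x y.

Lemma deg_rest_mass x : rest_mass [::] = rest_mass [:: x] + deg x.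
Proof.
rewrite (@rest_massE x) // /deg [in RHS](bigD1 x) //= M_diag add0r.
by congr (_ + _); apply: eq_bigl => y; rewrite inE.
Qed.

Lemma deg_split u v : u != v -> \sum_(y | y \notin [:: u; v]) M u y = deg u - M u v.
Proof.
move=> uv; rewrite /deg [in RHS](bigD1 v) //= [in RHS](bigD1 u) //=.
rewrite M_diag add0r addrC addrK; apply: eq_bigl => y.
by rewrite !inE negb_or andbC.
Qed.

Lemma sum_notin s (F : T -> R) : (forall y, y \in s -> F y = 0) ->
  \sum_y F y = \sum_(y | y \notin s) F y.
Proof.
move=> F0; rewrite [RHS]big_mkcond; apply: eq_bigr => y _.
by case: ifPn => // /negPn /F0.
Qed.

(** As [t] is still available, [M z t] is counted once in the mass [S] available at [z], so the sum
    is at most [S + M z t]. Since [M z t <= S], this is at most [c S + (2 - c) M z t]. *)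
Lemma last_step_available p (c q : R) t s z X : (forall x y, M x y <= p) ->
  1 <= c -> c <= 2 -> c * q = (2 - c) * p ->
  uniq (t :: s) -> perm_eq ([:: t] ++ z :: X) (t :: s) ->
  \sum_y chi (rcons (t :: s) y) * M z y <= c * (rest_mass X + q).
Proof.
move=> Mp c1 c2 cq us PE.
have : uniq (t :: z :: X) by rewrite (perm_uniq PE).
rewrite cons_uniq => /andP[tzX]; rewrite cons_uniq => /andP[zX _].
have := step_le_rest_mass zX; set S := \sum_(y | _) _ => SX.
have tS : M z t <= S.
  by rewrite /S (bigD1 t) //= lerDl sumr_ge0.
suff : \sum_y chi (rcons (t :: s) y) * M z y <= S + M z t.
  by have := Mp z t; nra.
have -> : S + M z t = \sum_y ((y \notin z :: X)%:R + (y == t)%:R) * M z y.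
  under eq_bigr do rewrite mulrDl !mulr_natl !mulrb.
  by rewrite big_split /= -!big_mkcond /= big_pred1_eq.
apply: ler_sum => y _; apply: ler_wpM2r => //; rewrite chi_rcons us.
rewrite -(perm_mem PE) [X in ~~ X]inE; case: eqP => [->|_] /=; first by rewrite tzX.
by rewrite addr0.
Qed.

(** The edges at [t] have been spent, so the closing edge is not part of the mass available at [z]
    and costs its full coefficient 2. *)
Lemma last_step_used p t s z X : M z t <= p -> uniq (t :: s) ->
  perm_eq (z :: X) (t :: s) ->
  \sum_y chi (rcons (t :: s) y) * M z y <= 1 * (rest_mass X + 2 * p).
Proof.
move=> Mp us PE.
have : uniq (z :: X) by rewrite (perm_uniq PE).
rewrite cons_uniq => /andP[zX _]; have := step_le_rest_mass zX.
set S := \sum_(y | _) _ => SX.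
suff : \sum_y chi (rcons (t :: s) y) * M z y <= S + 2 * M z t by lra.
have SE : S = \sum_y (y \notin z :: X)%:R * M z y.
  by rewrite /S big_mkcond; apply: eq_bigr => y _; case: ifP; rewrite ?mul1r ?mul0r.
have tE : M z t = \sum_y (y == t)%:R * M z y.
  rewrite -[LHS](big_pred1_eq +%R t (M z)) big_mkcond.
  by apply: eq_bigr => y _; case: ifP; rewrite ?mul1r ?mul0r.
rewrite SE tE mulr_sumr -big_split; apply: ler_sum => y _.
rewrite [leRHS]/= mulrA -mulrDl; apply: ler_wpM2r => //; rewrite chi_rcons us.
rewrite -(perm_mem PE); case: eqP => [->|_]; last by rewrite mulr0 addr0.
by rewrite mulr1 lerDr.
Qed.

(** The walk is explored from its first vertex [x]: the first step spends [deg x], and the walk can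
    only come back to [x] by its last step, along an edge of mass at most [r x]. *)
Lemma walk_sum_bound m (r : T -> R) : (forall x y, M x y <= r x) ->
  walk_sum m.+2 <= \sum_x deg x * ((rest_mass [:: x] + 2 * r x) / m.+1%:R) ^+ m.+1.
Proof.
move=> Mr; rewrite /walk_sum /=; apply: ler_sum => x _; rewrite /deg mulr_suml.
apply: ler_sum => y _.
have -> : \sum_z sumw m (fun s => chi [:: x, y, z & s] * (M x y * (M y z * pw z s)))
    = M x y * sumw m.+1 (fun s => chi (x :: [::] ++ y :: s) * pw y s).
  rewrite -sumwZ /=; apply: eq_bigr => z _; apply: eq_sumw => s _; ring.
apply: ler_wpM2l => //; have r0 : 0 <= r x by apply: le_trans (Mr x x).
rewrite -[leRHS]mul1r; apply: (@closed_arm_bound x [::]) => //; first by rewrite mulr_ge0.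
by move=> s z X; apply: last_step_used; rewrite M_sym.
Qed.

(* The closing edge satisfies [M z t <= min(p, s)], where [s] is the mass available
   to the last step, and [s + min(p, s) <= c (s + q)] whenever [1 <= c <= 2] and
   [c q = (2 - c) p]. *)
Section TwoArms.
Variables (p c q : R).
Hypotheses (Mp : forall x y, M x y <= p) (c1 : 1 <= c) (c2 : c <= 2).
Hypotheses (q0 : 0 <= q) (cq : c * q = (2 - c) * p).

(** The single arm leaves [v] by an edge other than [uv]. The walk starts at [u], whose remaining
    edges are unexplored, so the closing edge is still available. *)
Lemma two_arms0_bound u v l : u != v ->
  two_arms u v 0 l.+2 <=
    (deg v - M u v) * (c * ((rest_mass [:: v] + q) / l.+1%:R) ^+ l.+1).
Proof.
move=> uv; have c0 : 0 <= c := le_trans ler01 c1.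
have -> : two_arms u v 0 l.+2 =
    \sum_y sumw l.+1 (fun s => M v y * (chi (u :: [:: v] ++ y :: s) * pw y s)).
  rewrite -[LHS]/(sumw l.+2 (fun zs => chi (u :: v :: zs) * (1 * pw v zs))) sumwS.
  by apply: eq_bigr => y _; apply: eq_sumw => s _; rewrite [pw v _]/=; ring.
rewrite (M_sym u v) -deg_split 1?eq_sym //.
rewrite (sum_notin (s := [:: v; u])); last first.
  move=> y yuv; rewrite -[RHS](sumw0 R T l.+1).
  apply: eq_sumw => -[//|z s] _.
  rewrite -[_ :: _]/([:: u; v; y] ++ z :: s) chi_prefix ?mul0r ?mulr0 //=.
  by move: yuv; rewrite !inE => /orP[] /eqP ->; rewrite eqxx ?orbT ?andbF.
rewrite mulr_suml; apply: ler_sum => y yuv; rewrite sumwZ.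
apply: ler_wpM2l => //; apply: (@closed_arm_bound u [:: u]) => // s z X.
exact: last_step_available.
Qed.

(** The arm at [u] is explored first, then the arm at [v]. The walk starts at the far end of the
    first arm; no edge has been explored from that vertex, so the closing edge is again
    available. *)
Lemma two_armsS_bound u v i l : u != v ->
  two_arms u v i.+1 l.+1 <=
    (deg u - M u v) * (c * ((rest_mass [:: u] + q) / (i + l).+1%:R) ^+ (i + l).+1).
Proof.
move=> uv; have c0 : 0 <= c := le_trans ler01 c1.
pose C ys := sumw l.+1 (fun zs => chi (rev ys ++ u :: v :: zs) * pw v zs).
have CE ys : C ys = sumw l.+1 (fun zs => chi ((rev ys ++ [:: u]) ++ v :: zs) * pw v zs).
  by apply: eq_sumw => zs _; rewrite -catA.
have C0 ys : ~~ uniq (rev ys ++ [:: u; v]) -> C ys = 0.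
  move=> nu; rewrite -[RHS](sumw0 R T l.+1); apply: eq_sumw => -[//|z zs] _.
  by rewrite -[_ :: _]/([:: u; v] ++ z :: zs) catA chi_prefix ?mul0r.
have -> : two_arms u v i.+1 l.+1 =
    \sum_y sumw i (fun ys => M u y * (pw y ys * C (y :: ys))).
  apply: eq_bigr => y _; apply: eq_sumw => ys _; rewrite mulrA -sumwZ.
  by apply: eq_sumw => zs _; rewrite [pw u _]/=; ring.
rewrite -deg_split // (bigID (fun y => y \notin [:: u; v])) /= [X in _ + X]big1 ?addr0;
  last first.
  move=> y; rewrite negbK => yuv; rewrite -[RHS](sumw0 R T i).
  apply: eq_sumw => ys _; rewrite C0 ?mulr0 // cat_uniq.
  suff -> : has (mem (rev (y :: ys))) [:: u; v] by rewrite andbF.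
  apply/hasP; exists y => //; by rewrite /= mem_rev mem_head.
rewrite mulr_suml; apply: ler_sum => y yuv.
rewrite sumwZ; apply: ler_wpM2l => //.
have -> : sumw i (fun ys => pw y ys * C (y :: ys)) = sumw i (fun ys =>
    if uniq (y :: ys) && ~~ has (mem [:: u]) ys then pw y ys * C (y :: ys) else 0).
  apply: eq_sumw => ys _; case: ifPn => // nu; rewrite C0 ?mulr0 // cat_uniq rev_uniq.
  apply: contra nu => /and3P[-> hu _]; rewrite /=.
  apply: contra hu => /hasP[x xys xu].
  have /eqP <- : x == u by move: xu; rewrite /= inE.
  by rewrite /= mem_rev inE xys orbT.
have -> : ((i + l).+1 = l.+1 + i)%N by lia.
apply: arm_bound => // [|ys _ _ _]; first by move: yuv; rewrite !inE; case: (y == u).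
rewrite CE lastI rev_rcons; apply: (@closed_arm_bound _ [:: last y ys]) => //.
  by move=> s z X; exact: last_step_available.
by rewrite catrevE.
Qed.

End TwoArms.

End Arms.

(** * Lowering the mass of one edge *)

Section Perturbation.
Variables (R : realFieldType) (T : finType) (M : T -> T -> R).
Hypothesis M_ge0 : forall x y, 0 <= M x y.
Hypothesis M_sym : forall x y, M x y = M y x.
Variables (u v : T).
Hypothesis uv : u != v.

Definition shrink (t : R) x y : R :=
  M x y * (1 - t * ((x == u) && (y == v) || (x == v) && (y == u))%:R).

(** Bernoulli's inequality: a walk using the edge [N] times is multiplied by
    [(1 - t)^N >= 1 - t N]. *)
Lemma pwl_shrink (t : R) s : 0 <= t -> t <= 1 ->
  pwl M s * (1 - t * (count_step u v s + count_step v u s)%:R) <= pwl (shrink t) s.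
Proof.
move=> t0 t1; elim: s => [|x [|y s] IH]; try by rewrite /= mulr0 subr0 mulr1.
rewrite [pwl M _]/= [pwl (shrink t) _]/= /shrink.
rewrite [count_step u v _]/= [count_step v u _]/=.
rewrite -!/(count_step _ _ (y :: s)).
move: IH; set N := (count_step u v (y :: s) + count_step v u (y :: s))%N.
rewrite -[pwl M _]/(pw M y s) -[pwl _ _]/(pw (shrink t) y s) => IH.
rewrite addnACA -/N.
set b := (x == u) && (y == v); set b' := (x == v) && (y == u).
have -> : (b + b' = (b || b') :> nat)%N.
  by rewrite /b /b'; case: (x =P u) => [->|_] /=; rewrite ?(negPf uv) /= ?orbF ?addn0.
have A0 := pw_ge0 M_ge0 y s; have N0 : 0 <= N%:R :> R by [].
rewrite -!mulrA; apply: ler_wpM2l => //.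
set B := b || b'; have [B0 B1] : (0 <= (B%:R : R)) /\ (B%:R : R) <= 1.
  by case: (B); rewrite ?lexx ?ler01.
have tB : 0 <= 1 - t * B%:R by nra.
apply: le_trans (ler_wpM2l tB IH); rewrite mulrCA natrD; apply: ler_wpM2l => //.
have : 0 <= t * t * (B%:R * N%:R) by rewrite !mulr_ge0.
lra.
Qed.

(** The factor 2 comes from the two directions in which a walk may use [uv]; they contribute equally
    by reversal. *)
Lemma walk_sum_shrink k (t : R) : 0 <= t -> t <= 1 ->
  walk_sum M k.+1 - t * (2 * M u v * \sum_(i < k.+1) two_arms M u v i (k - i))
    <= walk_sum (shrink t) k.+1.
Proof.
move=> t0 t1.
have := sumw_count_arms M_sym u v k; have := sumw_count_arms M_sym v u k.
rewrite sum_two_armsC // (M_sym v u); set V := \sum_(i < _) _ => E1 E2.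
have -> : 2 * M u v * V = M u v * V + M u v * V by ring.
rewrite -{1}E1 -E2 -sumwD /walk_sum -sumwZ.
have -> (a b : R) : a - b = a + (-1) * b by ring.
rewrite -sumwZ -sumwD; apply: le_sumw => s _.
apply: le_trans (ler_wpM2l (chi_ge0 R s) (pwl_shrink s t0 t1)).
by rewrite natrD le_eqVlt; apply/orP; left; apply/eqP; ring.
Qed.

(* First-order optimality in the direction that removes mass from the edge [uv]. *)
Lemma optimality k : 0 < M u v -> 0 <= walk_sum M k.+1 ->
  (forall t : R, 0 < t -> t <= 1 / 2 -> t * M u v <= 1 / 2 ->
     walk_sum (shrink t) k.+1 <= walk_sum M k.+1 * (1 - t * M u v) ^+ k.+1) ->
  k.+1%:R * walk_sum M k.+1 <= 2 * \sum_(i < k.+1) two_arms M u v i (k - i).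
Proof.
move=> p0 Q0; set p := M u v; set V := \sum_(i < _) _; set Q := walk_sum M _ => H.
set m : R := k.+1%:R; have m0 : 0 < m by rewrite ltr0n.
have lin (h m' Q' V' w : R) : (Q' - 2 * V' * h) * (1 + m' * h) <= Q' * w -> Q' * w <= Q'
  * 1 ->
    h * (m' * Q') <= h * (2 * V' * (1 + m' * h)) by lra.
have key (t : R) : 0 < t -> t <= 1 / 2 -> t * p <= 1 / 2 -> m * Q <= 2 * V * (1 + m * (t
  * p)).
  move=> t0 t2 tp2; have := H t t0 t2 tp2.
  have := walk_sum_shrink k (ltW t0) (le_trans t2 _);
    rewrite -/V -/Q -/p => /(_ ltac:(lra)) H1 H2.
  set h : R := t * p in tp2 *; have h0 : 0 < h by rewrite mulr_gt0.
  have H3 : Q - 2 * V * h <= Q * (1 - h) ^+ k.+1.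
    by apply: le_trans (le_trans H1 H2); rewrite /h; lra.
  (* By Bernoulli [1 + m h <= (1 + h)^m], and [(1 - h)^m (1 + h)^m <= 1]. *)
  have B : (1 - h) ^+ k.+1 * (1 + m * h) <= 1.
    have b1 : 1 + m * h <= (1 + h) ^+ k.+1.
      rewrite /m mulr_natl; elim: (k.+1) => [|j IHj]; first by rewrite mulr0n addr0.
      rewrite exprS mulrS; have : 0 <= h *+ j by rewrite mulrn_wge0 // ltW.
      nra.
    have h1 : 0 <= (1 - h) ^+ k.+1 by rewrite exprn_ge0 //; lra.
    apply: le_trans (ler_wpM2l h1 b1) _; rewrite -exprMn; apply: exprn_ile1; nra.
  have : h * (m * Q) <= h * (2 * V * (1 + m * h)).
    have mh0 : 0 <= 1 + m * h by rewrite addr_ge0 // mulr_ge0 ?ltW.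
    by apply: lin (ler_wpM2l Q0 B); rewrite [leRHS]mulrA; exact: (ler_wpM2r mh0 H3).
  by rewrite ler_pM2l.
have V0 : 0 <= V.
  apply: sumr_ge0 => i _; apply: sumw_ge0 => ys; apply: sumw_ge0 => zs.
  by rewrite !mulr_ge0 ?chi_ge0 ?pw_ge0.
apply/ler_addgt0Pr => e e0.
(* With [t = 1 / D], the three summands of [D] give in turn [t <= 1/2], [t p <= 1/2] and an error
   [2 V m t p <= e]. *)
set D := 2 + 2 * p + 2 * V * m * p / e.
have W0 : 0 <= 2 * V * m * p / e by rewrite !mulr_ge0 ?invr_ge0 // ltW.
have p0' : 0 < p by [].
have D0 : 0 < D by rewrite /D; lra.
have tD : D^-1 * D = 1 by rewrite mulVf // gt_eqF.
have iD0 : 0 < D^-1 by rewrite invr_gt0.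
have := key D^-1 iD0; set t := D^-1 in tD iD0 *.
have tE : t * 2 + t * (2 * p) + t * (2 * V * m * p / e) = 1 by rewrite -!mulrDr -/D.
have t1 : 0 <= t * (2 * p) by rewrite !mulr_ge0 ?ltW.
have t2 : 0 <= t * (2 * V * m * p / e) by rewrite mulr_ge0 // ltW.
move=> /(_ ltac:(lra) ltac:(lra)) K; apply: le_trans K _.
have : e * (t * (2 * V * m * p / e)) <= e * 1 by apply: ler_wpM2l; [exact: ltW|lra].
have -> : e * (t * (2 * V * m * p / e)) = 2 * V * (m * (t * p)) by field; rewrite gt_eqF.
lra.
Qed.

End Perturbation.

(** * Bounds at an optimal weight *)

(** Here [p] is the mass of [uv] and [T] the mass of the other edges at [u] or [v]. Equality holds
    at [p = 1/3], [T = 2/3], the uniform triangle. *)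
Lemma three_arms_poly_le (R : realFieldType) (p T : R) : 0 <= p -> p <= 1/3 -> 0 <= T ->
  T <= 1 - p ->
  5 * p * T / 2 + T ^+ 2 / 4 + T * (1 - p - T) <= 2 / 3.
Proof.
move=> p0 p3 T0 Tp; case: (lerP (1/6) p) => p6; last by nra.
have : 0 <= (1 - p - T) * (p - 1/6 + (1 - p - T)) by apply: mulr_ge0; lra.
have : 0 <= (1/3 - p) * (1 - p) by apply: mulr_ge0; lra.
nra.
Qed.
(** Here [p] is the mass of [uv], [2 h] that of the edges adjacent to it and [g] that of the others.
    Equality holds at [p = h = g = 1/4], the uniform 4-cycle. *)
Lemma four_arms_poly_le_short (R : realFieldType) (p h g : R) : 0 <= p -> 0 <= h -> 0 <=
  g -> g <= h ->
  p + 2 * h + g = 1 -> g * h ^+ 2 + h * g ^+ 2 + p * h ^+ 2 + 5 * p * h * g <= 1 / 8.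
Proof.
move=> p0 h0 g0 gh e; have {e} pE : p = 1 - 2 * h - g by lra.
rewrite {}pE in p0 *.
(* Without [p], the left side is a concave quadratic in [g] with vertex [(5 - 10 h) / 8], which is
   at least [h] exactly when [18 h <= 5]. *)
case: (lerP (18 * h) 5) => h5.
  have : 0 <= h * (h - g) * (5 - 10 * h - 4 * (g + h)).
    by rewrite !mulr_ge0 //; lra.
  have : 0 <= (1 - 4 * h) ^+ 2 * (1 + 8 * h) by rewrite mulr_ge0 ?sqr_ge0 //; lra.
  nra.
have : 0 <= h * (g - (5 - 10 * h) / 8) ^+ 2 by rewrite mulr_ge0 ?sqr_ge0.
have h2 : h <= 1 / 2 by lra.
have : 0 <= (h - 5/18) * (1/2 - h) by rewrite mulr_ge0 //; lra.
nra.
Qed.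
Lemma four_arms_poly_le_long (R : realFieldType) (p h g : R) : 0 <= p -> 0 <= h -> h <= g
  ->
  p + 2 * h + g = 1 -> g * h ^+ 2 + h * g ^+ 2 + 6 * p * h ^+ 2 <= 1 / 8.
Proof.
move=> p0 h0 gh e.
have -> : p = 1 - 2 * h - g by lra.
(* This bounds [g^2] by its chord on [[h, 1 - 2 h]]. The rest is affine in [g] with slope of the
   sign of [1 - 6 h], so it is largest at an end of the interval. *)
have h1 : 0 <= h * ((g - h) * (1 - 2 * h - g)) by rewrite !mulr_ge0 //; lra.
have h2 : 0 <= (1 - 4 * h) ^+ 2 * (1 + 8 * h) by rewrite mulr_ge0 ?sqr_ge0 //; lra.
have h3 : h * (5 * h - 10 * h ^+ 2 + g * (1 - 6 * h)) <= 1 / 8.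
  case: (lerP (6 * h) 1) => h6.
    have : 0 <= h * (1 - 6 * h) * (1 - 2 * h - g) by rewrite !mulr_ge0 //; lra.
    nra.
  have : 0 <= h * (6 * h - 1) * (g - h) by rewrite !mulr_ge0 //; lra.
  nra.
nra.
Qed.

(** * The sum over all positions of a marked edge *)

Section EdgeBounds.
Variables (R : realFieldType) (T : finType) (M : T -> T -> R).
Hypothesis M_ge0 : forall x y, 0 <= M x y.
Hypothesis M_sym : forall x y, M x y = M y x.
Hypothesis M_diag : forall x, M x x = 0.
Hypothesis M_mass : rest_mass M [::] = 1.

(** The exploration bound from an end of degree [d] of a marked edge of mass [r]; [c] and [q]
    account for the closing edge. *)
Definition arm_value (k : nat) (c q r d : R) : R :=
  (d - r) * (c * ((1 - d + q) / k.+1%:R) ^+ k.+1).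

Lemma rest_mass1 x : rest_mass M [:: x] = 1 - deg M x.
Proof. by rewrite -M_mass (deg_rest_mass M_sym M_diag x) addrK. Qed.

(** In all positions but the first, the arm at [u] is nonempty and the exploration begins at [u]; in
    the first it begins at [v]. *)
Lemma sum_two_arms_bound k (p c q : R) u v : (forall x y, M x y <= p) ->
  1 <= c -> c <= 2 -> 0 <= q -> c * q = (2 - c) * p -> u != v ->
  \sum_(i < k.+3) two_arms M u v i (k.+2 - i) <=
    k.+2%:R * arm_value k c q (M u v) (deg M u) + arm_value k c q (M u v) (deg M v).
Proof.
move=> Mp c1 c2 q0 cq uv; rewrite big_ord_recl [leRHS]addrC; apply: lerD.
  apply: le_trans (two_arms0_bound M_ge0 M_sym M_diag Mp c1 c2 q0 cq _ uv) _.
  by rewrite rest_mass1.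
rewrite mulr_natl -[k.+2 in leRHS](card_ord k.+2) -sumr_const.
apply: ler_sum => i _; rewrite lift0 subSS.
have := ltn_ord i; rewrite ltnS leq_eqVlt => /orP[/eqP ->|ik].
  rewrite subnn -two_armsC // (M_sym u v).
  apply: le_trans (two_arms0_bound M_ge0 M_sym M_diag Mp c1 c2 q0 cq _ _) _;
    first by rewrite eq_sym.
  by rewrite rest_mass1.
have [l kE] : exists l, k = (i + l)%N by exists (k - i)%N; rewrite subnKC.
have -> : (k.+1 - i = l.+1)%N by lia.
apply: le_trans (two_armsS_bound M_ge0 M_sym M_diag Mp c1 c2 q0 cq _ _ uv) _.
by rewrite rest_mass1 -kE.
Qed.

Lemma deg_ge u v : M u v <= deg M u.
Proof. by rewrite /deg (bigD1 v) //= lerDl sumr_ge0. Qed.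

Lemma deg_le1 x : deg M x <= 1.
Proof. by rewrite -subr_ge0 -rest_mass1 rest_mass_ge0. Qed.

Lemma arm_value_le k c q u v x : 0 <= c -> 0 <= q -> M u v <= deg M x ->
  arm_value k c q (M u v) (deg M x) <= c * ((1 - M u v + q) / k.+2%:R) ^+ k.+2.
Proof.
move=> c0 q0 rd; rewrite /arm_value mulrCA; apply: ler_wpM2l => //.
have -> : 1 - M u v + q = (deg M x - M u v) + (1 - deg M x + q) by ring.
by apply: amgm; have := deg_le1 x; lra.
Qed.

Lemma sum_two_arms_le k (p c q : R) u v : (forall x y, M x y <= p) ->
  1 <= c -> c <= 2 -> 0 <= q -> c * q = (2 - c) * p -> u != v ->
  \sum_(i < k.+3) two_arms M u v i (k.+2 - i) <=
    k.+3%:R * (c * ((1 - M u v + q) / k.+2%:R) ^+ k.+2).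
Proof.
move=> Mp c1 c2 q0 cq uv; apply: le_trans (sum_two_arms_bound k Mp c1 c2 q0 cq uv) _.
set X := c * _.
have -> : k.+3%:R * X = k.+2%:R * X + X by rewrite -[k.+3%:R]natr1 [LHS]mulrDl mul1r.
have c0 : 0 <= c := le_trans ler01 c1.
apply: lerD; [apply: ler_wpM2l => //|]; apply: arm_value_le => //; first exact: deg_ge.
by rewrite M_sym deg_ge.
Qed.

(** The sum of squared degrees is the sum over edges [xy] of [N x y (deg x + deg y)], and the stars
    of [x] and [y] overlap only in [xy]. *)
Lemma sum_deg_sqr (N : T -> T -> R) (g : R) : (forall x y, 0 <= N x y) ->
  (forall x y, N x y = N y x) -> \sum_x deg N x = 2 * g ->
  (forall x y, N x y != 0 -> deg N x + deg N y <= g + N x y) ->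
  \sum_x deg N x ^+ 2 <= g ^+ 2 + 2^-1 * \sum_x \sum_y N x y ^+ 2.
Proof.
move=> N0 Ns Ng Nxy.
have -> : \sum_x deg N x ^+ 2 = 2^-1 * \sum_x \sum_y N x y * (deg N x + deg N y).
  have E : \sum_x \sum_y N x y * deg N x = \sum_x deg N x ^+ 2.
    by apply: eq_bigr => x _; rewrite -mulr_suml.
  have E' : \sum_x \sum_y N x y * deg N y = \sum_x deg N x ^+ 2.
    rewrite exchange_big -E; apply: eq_bigr => x _; apply: eq_bigr => y _.
    by rewrite Ns.
  have -> : \sum_x \sum_y N x y * (deg N x + deg N y) =
      \sum_x \sum_y N x y * deg N x + \sum_x \sum_y N x y * deg N y.
    rewrite -big_split; apply: eq_bigr => x _ /=; rewrite -big_split.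
    by apply: eq_bigr => y _; rewrite mulrDr.
  by rewrite E E'; field.
have -> : g ^+ 2 = 2^-1 * \sum_x \sum_y N x y * g.
  have -> : \sum_x \sum_y N x y * g = (\sum_x deg N x) * g.
    by rewrite mulr_suml; apply: eq_bigr => x _; rewrite -mulr_suml.
  by rewrite Ng; field.
rewrite -mulrDr -big_split /=; apply: ler_wpM2l; first by rewrite invr_ge0.
apply: ler_sum => x _; rewrite -big_split /=; apply: ler_sum => y _.
have [->|n0] := eqVneq (N x y) 0; first by rewrite !mul0r expr0n addr0.
by have := ler_wpM2l (N0 x y) (Nxy x y n0); lra.
Qed.

End EdgeBounds.

(** * Explicit estimates for walks with three and four edges *)

Section SmallCycles.
Variables (R : realFieldType) (T : finType) (M : T -> T -> R).
Hypothesis M_ge0 : forall x y, 0 <= M x y.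
Hypothesis M_sym : forall x y, M x y = M y x.
Hypothesis M_diag : forall x, M x x = 0.
Hypothesis M_mass : rest_mass M [::] = 1.
Variables (u v : T).
Hypothesis uv : u != v.
Hypothesis Mmax : forall x y, M x y <= M u v.

Lemma chi_sum h s (F : T -> R) : \sum_y chi R (rcons (h :: s) y) * F y =
  if uniq (h :: s) then 2 * F h + \sum_(y | y \notin h :: s) F y else 0.
Proof.
case: ifPn => us; last by rewrite big1 // => y _; rewrite chi_rcons (negPf us) mul0r.
rewrite (bigD1 h) // chi_rcons us eqxx; congr (_ + _).
rewrite [LHS]big_mkcond [RHS]big_mkcond; apply: eq_bigr => y _; rewrite chi_rcons us.
case: eqP => [->|_] /=; first by rewrite mem_head.
by case: ifP; rewrite ?mul1r ?mul0r.
Qed.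

(** The mass is sorted by its position relative to [uv]: [al] and [be] join [u] and [v] to other
    vertices, with totals [A] and [B], and [N] lives off [u] and [v], with mass [g]. Thus
    [p + A + B + g = 1]. *)
Let al x := if x \in [:: u; v] then 0 else M u x.
Let be x := if x \in [:: u; v] then 0 else M v x.
Let N x y := if (x \in [:: u; v]) || (y \in [:: u; v]) then 0 else M x y.
Let A := \sum_x al x.
Let B := \sum_x be x.
Let g := 1 - M u v - A - B.
Let p := M u v.

Local Lemma p_ge0 : 0 <= p. Proof. exact: M_ge0. Qed.
Local Lemma al_ge0 x : 0 <= al x. Proof. by rewrite /al; case: ifP. Qed.
Local Lemma be_ge0 x : 0 <= be x. Proof. by rewrite /be; case: ifP. Qed.
Local Lemma al_le x : al x <= p. Proof. by rewrite /al; case: ifP => // _;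
  exact: M_ge0. Qed.
Local Lemma be_le x : be x <= p. Proof. by rewrite /be; case: ifP => // _;
  exact: M_ge0. Qed.
Local Lemma N_ge0 x y : 0 <= N x y. Proof. by rewrite /N; case: ifP. Qed.
Local Lemma N_le x y : N x y <= p. Proof. by rewrite /N; case: ifP => // _;
  exact: M_ge0. Qed.
Local Lemma N_sym x y : N x y = N y x. Proof. by rewrite /N orbC M_sym. Qed.

Local Lemma sum_al : A = deg M u - p.
Proof.
rewrite -deg_split // /A (@sum_notin _ _ [:: u; v]) => [|y]; last by rewrite /al => ->.
by apply: eq_bigr => y; rewrite /al => /negPf ->.
Qed.

Local Lemma sum_be : B = deg M v - p.
Proof.
rewrite /p (M_sym u v) -deg_split 1?eq_sym // /B (@sum_notin _ _ [:: v; u]) => [|y].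
  by apply: eq_bigr => y; rewrite /be !inE orbC => /negPf ->.
by rewrite /be !inE orbC => ->.
Qed.

Local Lemma outer_massE : g = rest_mass M [:: u; v].
Proof.
have uNv : u \notin [:: v] by rewrite inE.
have := rest_massE M_sym M_diag uNv.
rewrite (rest_mass1 M_sym M_diag M_mass) deg_split // /g sum_al sum_be -/p; lra.
Qed.

Local Lemma degN x : x \notin [:: u; v] -> deg N x = \sum_(y | y \notin [:: x; u;
  v]) M x y.
Proof.
move=> xuv; rewrite /deg (@sum_notin _ _ [:: x; u; v]) => [|y].
  apply: eq_bigr => y; rewrite [_ \in _]inE negb_or => /andP[_ /negPf yuv].
  by rewrite /N (negPf xuv) yuv.
rewrite inE => /orP[/eqP->|yuv]; rewrite /N; first by rewrite M_diag if_same.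
by rewrite yuv orbT.
Qed.

Local Lemma degN_le x : deg N x <= g.
Proof.
rewrite outer_massE; have [xuv|xuv] := boolP (x \in [:: u; v]).
  by rewrite /deg big1 ?rest_mass_ge0 // => y _; rewrite /N xuv.
by rewrite degN //; exact: step_le_rest_mass.
Qed.

Local Lemma degN_add x y : x != y -> deg N x + deg N y <= g + N x y.
Proof.
move=> xy; have [xuv|xuv] := boolP (x \in [:: u; v]).
  rewrite /deg big1 ?add0r => [|z _]; last by rewrite /N xuv.
  by rewrite (le_trans (degN_le y)) // lerDl N_ge0.
have [yuv|yuv] := boolP (y \in [:: u; v]).
  rewrite addrC /deg big1 ?add0r => [|z _]; last by rewrite /N yuv.
  by rewrite (le_trans (degN_le x)) // lerDl N_ge0.
have yxuv : y \notin [:: x; u; v] by rewrite inE negb_or eq_sym xy.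
have := step_le_rest_mass M_ge0 M_sym M_diag yxuv.
rewrite outer_massE (rest_massE M_sym M_diag xuv) -degN //.
suff -> : deg N y = N x y + \sum_(z | z \notin [:: y, x, u & [:: v]]) M y z by lra.
rewrite degN // (bigD1 x) /=; last by rewrite inE negb_or xy.
rewrite M_sym /N (negPf xuv) (negPf yuv); congr (_ + _).
apply: eq_bigl => z; rewrite !inE !negb_or; by case: (z == y); case: (z == x);
  rewrite ?andbF ?andbT.
Qed.

Local Lemma sum_degN : \sum_x deg N x = 2 * g.
Proof.
rewrite outer_massE /rest_mass mulrA mulfV ?pnatr_eq0 // mul1r (@sum_notin _ _ [:: u;
  v]) => [|x xuv].
  apply: eq_bigr => x xuv; rewrite /deg (@sum_notin _ _ [:: u; v]) => [|y yuv].
    by apply: eq_bigr => y yuv; rewrite /N (negPf xuv) (negPf yuv).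
  by rewrite /N yuv orbT.
by rewrite /deg big1 // => y _; rewrite /N xuv.
Qed.

Lemma sum_notin_cons (X : seq T) w (f : T -> R) : w \notin X ->
  \sum_(y | y \notin X) f y = f w + \sum_(y | y \notin w :: X) f y.
Proof.
move=> wX; rewrite (bigD1 w) //=; congr (_ + _).
by apply: eq_bigl => y; rewrite inE negb_or andbC.
Qed.

Lemma eq_sum_notin (X X' : seq T) (f : T -> R) : X =i X' ->
  \sum_(y | y \notin X) f y = \sum_(y | y \notin X') f y.
Proof. by move=> XX'; apply: eq_bigl => y; rewrite XX'. Qed.

Lemma two_arms02E a b : two_arms M a b 0 2 = \sum_w M b w *
  (if uniq [:: a; b; w] then 2 * M w a + \sum_(y | y \notin [:: a; b; w]) M w y else 0).
Proof.
apply: eq_bigr => w _; rewrite -chi_sum mulr_sumr; apply: eq_bigr => y _.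
by rewrite [rcons _ _]/= [pw _ _ _]/= [pw _ b _]/= [rev _ ++ _]/=; ring.
Qed.

Lemma two_arms03E a b : two_arms M a b 0 3 = \sum_z \sum_t M b z * M z t *
  (if uniq [:: a; b; z; t] then 2 * M t a + \sum_(y | y \notin [:: a; b; z;
    t]) M t y else 0).
Proof.
apply: eq_bigr => z _; apply: eq_bigr => t _; rewrite -chi_sum mulr_sumr.
apply: eq_bigr => y _.
by rewrite [rcons _ _]/= [pw _ _ _]/= [pw _ b _]/= [rev _ ++ _]/=; ring.
Qed.

Lemma two_arms11E a b : two_arms M a b 1 1 = \sum_w M a w *
  (if uniq [:: w; a; b] then 2 * M b w + \sum_(y | y \notin [:: w; a; b]) M b y else 0).
Proof.
apply: eq_bigr => w _; rewrite -chi_sum mulr_sumr; apply: eq_bigr => y _.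
by rewrite [rcons _ _]/= [pw _ _ _]/= [pw _ b _]/= [rev _ ++ _]/=; ring.
Qed.

Lemma two_arms12E a b : two_arms M a b 1 2 = \sum_w \sum_z M a w * M b z *
  (if uniq [:: w; a; b; z] then 2 * M z w + \sum_(y | y \notin [:: w; a; b;
    z]) M z y else 0).
Proof.
apply: eq_bigr => w _; apply: eq_bigr => z _; rewrite -chi_sum mulr_sumr.
apply: eq_bigr => y _.
by rewrite [rcons _ _]/= [pw _ _ _]/= [pw _ b _]/= [rev _ ++ _]/=; ring.
Qed.

Lemma two_arms21E a b : two_arms M a b 2 1 = \sum_y \sum_x M a y * M y x *
  (if uniq [:: x; y; a; b] then 2 * M b x + \sum_(z | z \notin [:: x; y; a;
    b]) M b z else 0).
Proof.
apply: eq_bigr => z _; apply: eq_bigr => t _; rewrite -chi_sum mulr_sumr.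
apply: eq_bigr => y _.
by rewrite [rcons _ _]/= [pw _ _ _]/= [pw _ b _]/= [rev _ ++ _]/=; ring.
Qed.

Local Lemma be_in x : x \in [:: u; v] -> be x = 0. Proof. by rewrite /be => ->. Qed.
Local Lemma al_in x : x \in [:: u; v] -> al x = 0. Proof. by rewrite /al => ->. Qed.
Local Lemma be_out x : x \notin [:: u;
  v] -> be x = M v x. Proof. by rewrite /be => /negPf ->. Qed.
Local Lemma al_out x : x \notin [:: u;
  v] -> al x = M u x. Proof. by rewrite /al => /negPf ->. Qed.

(** From [v] the walk goes to [w], then either closes up at [u] (coefficient 2) or ends at a new
    vertex, along an edge counted in [deg N w <= g]. *)
Local Lemma two_arms02_le : two_arms M u v 0 2 <= \sum_w be w * (2 * al w + g).
Proof.
rewrite two_arms02E; apply: ler_sum => w _; have [wuv|wuv] := boolP (w \in [:: u; v]).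
  rewrite be_in // mul0r; case: ifP; rewrite ?mulr0 // => /=.
  by move: wuv; rewrite !inE => /orP[] /eqP ->; rewrite eqxx ?orbT ?andbF.
rewrite be_out // al_out //; apply: ler_wpM2l => //; case: ifP => _.
  rewrite (M_sym w) lerD2l (le_trans _ (degN_le w)) // degN //.
  by rewrite (@eq_sum_notin _ [:: w; u; v]) // => x; rewrite !inE orbA orbC.
by rewrite addr_ge0 ?mulr_ge0 // outer_massE rest_mass_ge0.
Qed.

Local Lemma two_arms20_le : two_arms M v u 0 2 <= \sum_w al w * (2 * be w + g).
Proof.
rewrite two_arms02E; apply: ler_sum => w _; have [wuv|wuv] := boolP (w \in [:: u; v]).
  rewrite al_in // mul0r; case: ifP; rewrite ?mulr0 // => /=.
  by move: wuv; rewrite !inE => /orP[] /eqP ->; rewrite eqxx ?orbT ?andbF.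
rewrite be_out // al_out //; apply: ler_wpM2l => //; case: ifP => _.
  rewrite (M_sym w) lerD2l (le_trans _ (degN_le w)) // degN //.
  by rewrite (@eq_sum_notin _ [:: w; u; v]) // => x;
    rewrite !inE orbA orbC [(x == v) || _]orbC.
by rewrite addr_ge0 ?mulr_ge0 // outer_massE rest_mass_ge0.
Qed.

Local Lemma sum_be_out : B = \sum_(y | y \notin [:: u; v]) M v y.
Proof.
rewrite /B (@sum_notin _ _ [:: u; v]) => [|x]; last exact: be_in.
by apply: eq_bigr => x /be_out.
Qed.

Local Lemma two_arms11_le : two_arms M u v 1 1 <= \sum_w al w * (be w + B).
Proof.
rewrite two_arms11E; apply: ler_sum => w _; have [wuv|wuv] := boolP (w \in [:: u; v]).
  rewrite al_in // mul0r; case: ifP; rewrite ?mulr0 // => /=.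
  by rewrite wuv.
rewrite be_out // al_out //; apply: ler_wpM2l => //; case: ifP => _.
  by rewrite sum_be_out (sum_notin_cons _ wuv) le_eqVlt; apply/orP; left; apply/eqP; ring.
by rewrite addr_ge0 // sumr_ge0 // => x _; apply: be_ge0.
Qed.

Local Lemma A_ge0 : 0 <= A. Proof. by apply: sumr_ge0 => x _; apply: al_ge0. Qed.
Local Lemma B_ge0 : 0 <= B. Proof. by apply: sumr_ge0 => x _; apply: be_ge0. Qed.
Local Lemma g_ge0 : 0 <= g. Proof. by rewrite outer_massE rest_mass_ge0. Qed.

(** The three positions add up to [5 c + A B + (A + B) g], where [c] is the weight of the triangles
    on [uv] without [p]. Then [c <= p A] and [c <= p B] give [c <= p (A + B) / 2]. *)
Lemma three_arms_bound : M u v <= 1 / 3 ->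
  \sum_(i < 3) two_arms M u v i (2 - i) <= 2 / 3.
Proof.
move=> p3; rewrite !big_ord_recl big_ord0 addr0 [X in _ + (_ + X)](two_armsC M v u).
rewrite -[X in X + (_ + _)]/(two_arms M u v 0 2) -[X in _ + (X + _)]/(two_arms M u v 1 1).
rewrite -[X in _ + (_ + X)]/(two_arms M v u 0 2).
pose c := \sum_x al x * be x.
have E1 : \sum_w be w * (2 * al w + g) = 2 * c + B * g.
  rewrite mulr_suml mulr_sumr -big_split; apply: eq_bigr => x _ /=; ring.
have E2 : \sum_w al w * (2 * be w + g) = 2 * c + A * g.
  rewrite mulr_suml mulr_sumr -big_split; apply: eq_bigr => x _ /=; ring.
have E3 : \sum_w al w * (be w + B) = c + A * B.
  rewrite [A * B]mulr_suml -big_split; apply: eq_bigr => x _ /=; ring.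
have cA : c <= p * A.
  rewrite mulr_sumr; apply: ler_sum => x _; rewrite mulrC; apply: ler_wpM2r.
    exact: al_ge0.
  exact: be_le.
have cB : c <= p * B.
  rewrite mulr_sumr; apply: ler_sum => x _; apply: ler_wpM2r; first exact: be_ge0.
  exact: al_le.
have := two_arms02_le; have := two_arms20_le; have := two_arms11_le.
rewrite E1 E2 E3; have := g_ge0; have := A_ge0; have := B_ge0; have := p_ge0.
move: cA cB; rewrite /g -/p => cA cB p0 B0 A0 g0 H1 H2 H3.
have := @three_arms_poly_le R p (A + B) p0 p3 (addr_ge0 A0 B0) _.
move=> /(_ ltac:(lra)) N3; have : 0 <= (A - B) ^+ 2 by rewrite sqr_ge0.
nra.
Qed.

Local Lemma two_arms03_le : two_arms M u v 0 3 <=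
  \sum_z \sum_t be z * N z t * (2 * al t + (deg N t - N z t)).
Proof.
rewrite two_arms03E; apply: ler_sum => z _; apply: ler_sum => t _.
have [zuv|zuv] := boolP (z \in [:: u; v]).
  rewrite be_in // !mul0r; case: ifP; rewrite ?mulr0 // => /=.
  by move: zuv; rewrite !inE => /orP[] /eqP ->; rewrite eqxx ?orbT ?andbF.
have [tuv|tuv] := boolP (t \in [:: u; v]).
  rewrite /N tuv orbT mulr0 mul0r; case: ifP; rewrite ?mulr0 // => /=.
  by move: tuv; rewrite !inE => /orP[] /eqP ->; rewrite eqxx ?orbT ?andbF.
have NE : N z t = M z t by rewrite /N (negPf zuv) (negPf tuv).
have [zt|zt] := eqVneq z t; first by rewrite NE zt M_diag !mulr0 !mul0r.
rewrite be_out // al_out // NE; apply: ler_wpM2l; first by rewrite mulr_ge0.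
have ztuv : z \notin [:: t; u; v] by rewrite inE negb_or zt.
rewrite degN // (sum_notin_cons _ ztuv) (M_sym t z) (M_sym u t) [M z t + _]addrC addrK.
case: ifP => _; last by rewrite addr_ge0 ?mulr_ge0 // sumr_ge0.
rewrite lerD2l le_eqVlt; apply/orP; left; apply/eqP; apply: eq_sum_notin => x.
by rewrite !inE; do !case: (_ == _).
Qed.

Local Lemma two_arms30_le : two_arms M v u 0 3 <=
  \sum_z \sum_t al z * N z t * (2 * be t + (deg N t - N z t)).
Proof.
rewrite two_arms03E; apply: ler_sum => z _; apply: ler_sum => t _.
have [zuv|zuv] := boolP (z \in [:: u; v]).
  rewrite al_in // !mul0r; case: ifP; rewrite ?mulr0 // => /=.
  by move: zuv; rewrite !inE => /orP[] /eqP ->; rewrite eqxx ?orbT ?andbF.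
have [tuv|tuv] := boolP (t \in [:: u; v]).
  rewrite /N tuv orbT mulr0 mul0r; case: ifP; rewrite ?mulr0 // => /=.
  by move: tuv; rewrite !inE => /orP[] /eqP ->; rewrite eqxx ?orbT ?andbF.
have NE : N z t = M z t by rewrite /N (negPf zuv) (negPf tuv).
have [zt|zt] := eqVneq z t; first by rewrite NE zt M_diag !mulr0 !mul0r.
rewrite be_out // al_out // NE; apply: ler_wpM2l; first by rewrite mulr_ge0.
have ztuv : z \notin [:: t; u; v] by rewrite inE negb_or zt.
rewrite degN // (sum_notin_cons _ ztuv) (M_sym t z) (M_sym v t) [M z t + _]addrC addrK.
case: ifP => _; last by rewrite addr_ge0 ?mulr_ge0 // sumr_ge0.
rewrite lerD2l le_eqVlt; apply/orP; left; apply/eqP; apply: eq_sum_notin => x.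
by rewrite !inE; do !case: (_ == _).
Qed.

Local Lemma two_arms12_le : two_arms M u v 1 2 <=
  \sum_w \sum_z al w * be z * N w z + \sum_w \sum_z (if w == z then 0 else al w * be z *
    deg N z).
Proof.
rewrite two_arms12E -big_split; apply: ler_sum => w _; rewrite -big_split;
  apply: ler_sum => z _ /=.
have [wuv|wuv] := boolP (w \in [:: u; v]).
  rewrite al_in // !mul0r if_same addr0; case: ifP; rewrite ?mulr0 // => /=.
  by move: wuv; rewrite !inE => /orP[] ->; rewrite ?orbT.
have [zuv|zuv] := boolP (z \in [:: u; v]).
  rewrite be_in // mulr0 !mul0r if_same addr0; case: ifP; rewrite ?mulr0 // => /=.
  by move: zuv; rewrite !inE => /orP[] /eqP ->; rewrite eqxx ?orbT ?andbF.
have NE : N w z = M w z by rewrite /N (negPf zuv) (negPf wuv).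
have [wz|wz] := eqVneq w z.
  rewrite NE wz M_diag mulr0 addr0; case: ifP; rewrite ?mulr0 // => /=.
  by rewrite !inE eqxx !orbT.
rewrite be_out // al_out // NE -mulrDr; apply: ler_wpM2l; first by rewrite mulr_ge0.
have wzuv : w \notin [:: z; u; v] by rewrite inE negb_or wz.
rewrite degN // (sum_notin_cons _ wzuv) (M_sym z w).
case: ifP => _; last by rewrite !addr_ge0 // sumr_ge0.
rewrite addrA -mulr2n mulr_natl lerD2l le_eqVlt; apply/orP; left; apply/eqP;
  apply: eq_sum_notin => x.
by rewrite !inE; do !case: (_ == _).
Qed.

Local Lemma two_arms21_le : two_arms M u v 2 1 <=
  \sum_w \sum_z al w * be z * N w z + \sum_w \sum_z (if w == z then 0 else al w * be z *
    deg N w).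
Proof.
have -> : \sum_w \sum_z (if w == z then 0 else al w * be z * deg N w) =
    \sum_w \sum_x al w * N w x * (B - be w).
  apply: eq_bigr => w _; rewrite -mulr_suml -mulr_sumr.
  have -> : B - be w = \sum_(z | z != w) be z by rewrite /B (bigD1 w) //= addrC addrK.
  rewrite [LHS](bigD1 w) //= eqxx add0r mulr_sumr; apply: eq_bigr => z;
    rewrite eq_sym => /negPf ->.
  by rewrite /deg; ring.
rewrite two_arms21E -big_split; apply: ler_sum => y _; rewrite -big_split;
  apply: ler_sum => x _ /=.
have [yuv|yuv] := boolP (y \in [:: u; v]).
  rewrite al_in // !mul0r addr0; case: ifP; rewrite ?mulr0 // => /=.
  by rewrite andbF.
have [xuv|xuv] := boolP (x \in [:: u; v]).
  rewrite /N xuv orbT !mulr0 mul0r addr0; case: ifP; rewrite ?mulr0 // => /=.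
  by move: xuv; rewrite !inE => /orP[] /eqP ->; rewrite eqxx ?orbT ?andbF.
have NE : N y x = M y x by rewrite /N (negPf xuv) (negPf yuv).
have [yx|yx] := eqVneq y x; first by rewrite NE yx M_diag !mulr0 !mul0r addr0.
have -> : al y * be x * N y x + al y * N y x * (B - be y) =
  al y * N y x * (be x + (B - be y)) by ring.
rewrite !be_out // al_out // NE; apply: ler_wpM2l; first by rewrite mulr_ge0.
have xyuv : x \notin [:: y; u; v] by rewrite inE negb_or eq_sym yx.
rewrite sum_be_out (sum_notin_cons _ yuv) (sum_notin_cons _ xyuv) [M v y + _]addrC addrK.
case: ifP => _; last by rewrite !addr_ge0 // sumr_ge0.
by rewrite addrA -mulr2n mulr_natl.
Qed.

Lemma sum_sqr_le (n : T -> R) : (forall x, 0 <= n x) -> \sum_x n x ^+ 2 <= (\sum_x n x)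
  ^+ 2.
Proof.
move=> n0; rewrite expr2 mulr_suml; apply: ler_sum => x _; rewrite expr2.
by apply: ler_wpM2l => //; rewrite (bigD1 x) //= lerDl sumr_ge0.
Qed.

(** The difference on the right is a sum over ordered pairs of distinct vertices; the pairs
    containing [z] alone contribute [2 n z (S - n z)], with [S] the sum of [n]. *)
Lemma sum_pairs_le (n tau : T -> R) : (forall x, 0 <= n x) -> (forall x, 0 <= tau x) ->
  2 * (\sum_z tau z * n z * (\sum_x n x - n z)) <=
    (\sum_z tau z) * ((\sum_x n x) ^+ 2 - \sum_x n x ^+ 2).
Proof.
move=> n0 t0; rewrite mulr_sumr mulr_suml; apply: ler_sum => z _.
have -> : 2 * (tau z * n z * (\sum_x n x - n z)) = tau z * (2 * n z * (\sum_x n x - n z))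
  by ring.
apply: ler_wpM2l => //.
have -> : \sum_x n x = n z + \sum_(x | x != z) n x by rewrite (bigD1 z).
have -> : \sum_x n x ^+ 2 = n z ^+ 2 + \sum_(x | x != z) n x ^+ 2 by rewrite (bigD1 z).
have : \sum_(x | x != z) n x ^+ 2 <= (\sum_(x | x != z) n x) ^+ 2.
  rewrite !(big_mkcond (fun x => x != z)) /=.
  rewrite (eq_bigr (fun x => (if x != z then n x else 0) ^+ 2)) => [|x _].
    by apply: sum_sqr_le => x; case: ifP.
  by case: ifP; rewrite ?expr0n.
lra.
Qed.

(** [cc] weighs the 4-cycles through [uv] without the factor [p], [L] the paths having [uv] as an
    end edge and their last two edges in [N]. *)
Let cc := \sum_x \sum_y al x * be y * N x y.
Let L := \sum_z \sum_t (al z + be z) * N z t * (deg N t - N z t).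
Let q := 2^-1 * \sum_x \sum_y N x y ^+ 2.

Local Lemma cc_sym : cc = \sum_x \sum_y be x * al y * N x y.
Proof.
rewrite exchange_big; apply: eq_bigr => x _; apply: eq_bigr => y _.
by rewrite N_sym; ring.
Qed.

(** The two one-sided positions give [4 cc + L]. The other two give [2 cc] and terms in
    [deg N w + deg N z <= g + N w z], hence at most [g A B] and one more [cc]. *)
Local Lemma four_arms_split :
  \sum_(i < 4) two_arms M u v i (3 - i) <= 7 * cc + g * A * B + L.
Proof.
rewrite !big_ord_recl big_ord0 addr0 [X in _ + (_ + (_ + X))](two_armsC M v u).
rewrite -[X in X + (_ + (_ + _))]/(two_arms M u v 0 3) -[X in _ + (X + _)]/(two_arms M u
  v 1 2).
rewrite -[X in _ + (_ + (X + _))]/(two_arms M u v 2 1) -[X in _ + (_ + (_ +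
  X))]/(two_arms M v u 0 3).
set Y1 := \sum_w \sum_z (if w == z then 0 else al w * be z * deg N z).
set Y2 := \sum_w \sum_z (if w == z then 0 else al w * be z * deg N w).
have Y12 : Y1 + Y2 <= g * A * B + cc.
  have -> : g * A * B + cc = \sum_w \sum_z (al w * be z * (g + N w z)).
    have -> : g * A * B = \sum_w \sum_z al w * be z * g.
      have -> : g * A * B = A * (B * g) by ring.
      by rewrite mulr_suml; apply: eq_bigr => w _; rewrite -mulr_suml -mulr_sumr mulrA.
    rewrite -big_split; apply: eq_bigr => w _ /=; rewrite -big_split.
    by apply: eq_bigr => z _ /=; ring.
  rewrite -big_split; apply: ler_sum => w _; rewrite -big_split; apply: ler_sum => z _ /=.
  case: eqVneq => [_|wz].
    by rewrite addr0 !mulr_ge0 ?al_ge0 ?be_ge0 // addr_ge0 ?N_ge0 // g_ge0.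
  rewrite -mulrDr; apply: ler_wpM2l; first by rewrite mulr_ge0 ?al_ge0 ?be_ge0.
  by rewrite addrC degN_add.
have E : \sum_z \sum_t be z * N z t * (2 * al t + (deg N t - N z t)) +
    \sum_z \sum_t al z * N z t * (2 * be t + (deg N t - N z t)) = 4 * cc + L.
  have -> : 4 * cc = 2 * cc + 2 * cc by ring.
  rewrite {1}cc_sym /cc /L !mulr_sumr -!big_split; apply: eq_bigr => z _ /=.
  by rewrite !mulr_sumr -!big_split; apply: eq_bigr => t _ /=; ring.
have := two_arms03_le; have := two_arms30_le; have := two_arms12_le;
  have := two_arms21_le.
rewrite -/Y1 -/Y2 -/cc; lra.
Qed.

Local Lemma L_le : L <= (A + B) / 2 * (g ^+ 2 - q).
Proof.
have T0 : 0 <= A + B by rewrite addr_ge0 ?A_ge0 ?B_ge0.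
have sq : \sum_x deg N x ^+ 2 <= g ^+ 2 + q.
  apply: sum_deg_sqr => [|||x y Nxy]; [exact: N_ge0|exact: N_sym|exact: sum_degN|].
  apply: degN_add; apply: contraNneq Nxy => ->.
  by rewrite /N M_diag if_same.
have : 2 * L <= (A + B) * (\sum_x deg N x ^+ 2 - 2 * q).
  have -> : 2 * q = \sum_t \sum_x N x t ^+ 2 by rewrite /q exchange_big; field.
  rewrite /L exchange_big mulr_sumr -sumrB mulr_sumr; apply: ler_sum => t _.
  have degE : deg N t = \sum_x N x t by apply: eq_bigr => x _; exact: N_sym.
  rewrite /A /B -big_split degE; apply: sum_pairs_le => x; first exact: N_ge0.
  by rewrite addr_ge0 ?al_ge0 ?be_ge0.
have := ler_wpM2l T0 sq; lra.
Qed.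

Let k x y := al x * be y + al y * be x.

Local Lemma k_le x y : x != y -> k x y <= p * (A + B) / 2.
Proof.
move=> xy.
have two (f : T -> R) : (forall z, 0 <= f z) -> f x + f y <= \sum_z f z.
  move=> f0; rewrite (bigD1 x) //= (bigD1 y) 1?eq_sym //= addrA lerDl.
  exact: sumr_ge0.
have fA := ler_wpM2l p_ge0 (two al al_ge0); have fB := ler_wpM2l p_ge0 (two be be_ge0).
have := ler_wpM2r (be_ge0 y) (al_le x); have := ler_wpM2r (be_ge0 x) (al_le y).
have := ler_wpM2l (al_ge0 x) (be_le y); have := ler_wpM2l (al_ge0 y) (be_le x).
rewrite /k -/A -/B in fA fB *; lra.
Qed.

Local Lemma sum_k (f : T -> T -> R) : (forall x y, f x y = f y x) ->
  \sum_x \sum_y k x y * f x y = 2 * \sum_x \sum_y al x * be y * f x y.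
Proof.
move=> fs; set S := \sum_x \sum_y al x * be y * f x y.
have -> : 2 * S = S + S by ring.
rewrite {2}/S [X in _ + X]exchange_big -big_split; apply: eq_bigr => x _ /=.
rewrite -big_split; apply: eq_bigr => y _ /=; rewrite (fs y x) /k; ring.
Qed.

Lemma four_arms_bound : M u v <= 1 / 4 ->
  \sum_(i < 4) two_arms M u v i (3 - i) <= 1 / 8.
Proof.
move=> p4; apply: le_trans four_arms_split _.
have p0 := p_ge0; have A0 := A_ge0; have B0 := B_ge0; have g0 := g_ge0; have Lle := L_le.
have AB : A * B = \sum_x \sum_y al x * be y.
  by rewrite mulr_suml; apply: eq_bigr => x _; rewrite mulr_sumr.
have kN x y : k x y * N x y <= p * (A + B) / 2 * N x y.
  have [->|xy] := eqVneq x y; first by rewrite /N M_diag if_same !mulr0.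
  by apply: ler_wpM2r; [exact: N_ge0|exact: k_le].
have c1 : cc <= p * (A * B).
  rewrite AB /cc mulr_sumr; apply: ler_sum => x _; rewrite mulr_sumr;
    apply: ler_sum => y _.
  rewrite mulrC; apply: ler_wpM2r; last exact: N_le.
  by rewrite mulr_ge0 ?al_ge0 ?be_ge0.
have c2 : 2 * cc <= p * (A + B) * g.
  rewrite /cc -(sum_k N_sym).
  have -> : p * (A + B) * g = \sum_x \sum_y p * (A + B) / 2 * N x y.
    have -> : p * (A + B) * g = p * (A + B) / 2 * \sum_x deg N x by rewrite sum_degN;
      field.
    by rewrite mulr_sumr; apply: eq_bigr => x _; rewrite mulr_sumr.
  by apply: ler_sum => x _; apply: ler_sum => y _.
(* Pointwise, [k (2 N - p) <= k N^2 / p <= (A + B) N^2 / 2]. *)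
have c3 : 4 * cc - 2 * p * (A * B) <= (A + B) * q.
  have -> : 4 * cc - 2 * p * (A * B) = \sum_x \sum_y k x y * (2 * N x y - p).
    rewrite (sum_k (f := fun x y => 2 * N x y - p)) => [|x y]; last by rewrite N_sym.
    rewrite AB /cc !mulr_sumr -sumrB; apply: eq_bigr => x _; rewrite !mulr_sumr -sumrB.
    by apply: eq_bigr => y _; ring.
  have -> : (A + B) * q = \sum_x \sum_y (A + B) / 2 * N x y ^+ 2.
    rewrite /q mulrA mulr_sumr; apply: eq_bigr => x _; rewrite mulr_sumr.
    by apply: eq_bigr => y _.
  apply: ler_sum => x _; apply: ler_sum => y _.
  have k0 : 0 <= k x y by rewrite addr_ge0 // mulr_ge0 ?al_ge0 ?be_ge0.
  have [xy|xy] := eqVneq x y.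
    have -> : N x y = 0 by rewrite xy /N M_diag if_same.
    by have := mulr_ge0 k0 p0; lra.
  have [p00|pn] := eqVneq p 0.
    have -> : k x y = 0.
      by apply: le_anti; rewrite k0 andbT (le_trans (k_le xy)) // p00 !mul0r.
    by rewrite mul0r mulr_ge0 ?sqr_ge0 // divr_ge0 // addr_ge0.
  have pp : 0 < p by rewrite lt_neqAle eq_sym pn.
  rewrite -(ler_pM2l pp); set n := N x y.
  have := ler_wpM2r (sqr_ge0 n) (k_le xy).
  have := mulr_ge0 k0 (sqr_ge0 (n - p)); lra.
have AB4 : A * B <= ((A + B) / 2) ^+ 2 by have := sqr_ge0 (A - B); lra.
set h := (A + B) / 2 in Lle AB4.
have hE : A + B = 2 * h by rewrite /h; lra.
have h0 : 0 <= h by rewrite /h; lra.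
have pE : p + 2 * h + g = 1 by rewrite -hE /g /p; lra.
have gAB := ler_wpM2l g0 AB4; have pAB := ler_wpM2l p0 AB4.
rewrite hE in c2 c3.
(* By [c3], two of the seven copies of [cc] cost [p A B + h q], and [h q] cancels against the saving
   in [L_le]. *)
have key : 7 * cc + g * A * B + L <= g * h ^+ 2 + h * g ^+ 2 + p * h ^+ 2 + 5 * cc by nra.
apply: le_trans key _.
(* The other five copies are bounded by [cc <= p h g] from [c2] if [g <= h], and by [cc <= p h^2]
   from [c1] otherwise. *)
case: (lerP g h) => gh.
  by have := four_arms_poly_le_short p0 h0 g0 gh pE; lra.
by have := four_arms_poly_le_long p0 h0 (ltW gh) pE; lra.
Qed.

End SmallCycles.

(** * Numerical bounds on powers and exponentials *)

Section Numerics.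
Variable R : realType.

Lemma expR_nat (n : nat) (x : R) : expR (n%:R * x) = expR x ^+ n.
Proof. by rewrite expRM_natl. Qed.

(** The inequality [z <= e^(z - 1)], raised to the power [n + 1]. *)
Lemma pow_le_expR (n : nat) (b N : R) : 0 <= b -> 0 <= N ->
  (b / n.+1%:R) ^+ n.+1 * N ^+ n.+1 <= expR (N * b - n.+1%:R).
Proof.
move=> b0 N0; rewrite -exprMn; set z := _ * _.
have z0 : 0 <= z by rewrite /z !mulr_ge0 ?invr_ge0.
have -> : N * b - n.+1%:R = n.+1%:R * (z - 1).
  have : n.+1%:R != 0 :> R by rewrite pnatr_eq0.
  by rewrite /z; move: (n.+1%:R) => c c0; field.
rewrite expR_nat; apply: lerXn2r; rewrite ?nnegrE ?expR_ge0 //.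
by have := expR_ge1Dx (z - 1); lra.
Qed.

Let f : R := expR (1 / 50).

Local Lemma f_bound : 102 / 100 <= f /\ f <= (1020 + 305 / 1000) / 1000.
Proof.
have E : f = expR (1 / 100) ^+ 2 by rewrite -expR_nat; congr expR; field.
split; first by have := expR_ge1Dx (1 / 50 : R); rewrite -/f; lra.
have g0 := expR_gt0 (1 / 100 : R).
have H : expR (1 / 100 : R) * expR (- (1 / 100)) = 1 by rewrite expRxMexpNx_1.
have H' := expR_ge1Dx (- (1 / 100) : R).
have : expR (1 / 100 : R) * (99 / 100) <= 1.
  by have := ler_wpM2l (ltW g0) H'; rewrite H; lra.
rewrite E; set g := expR _ in g0 * => gle; have g1 : g <= 100 / 99 by lra.
have : g ^+ 2 <= (100 / 99) ^+ 2 by apply: lerXn2r; rewrite ?nnegrE; lra.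
move=> /le_trans; apply; lra.
Qed.

Lemma sqr_le (x y z : R) : 0 <= x -> x <= y -> y * y <= z -> x * x <= z.
Proof. by move=> x0 xy; apply: le_trans; apply: ler_pM. Qed.

Lemma mul_le (x y x' y' z : R) : 0 <= x -> x <= x' -> 0 <= y -> y <= y' -> x' * y' <= z
  -> x * y <= z.
Proof. by move=> x0 xx y0 yy; apply: le_trans; apply: ler_pM. Qed.

Local Lemma fX (n : nat) (x : R) : n%:R = 50 * x -> expR x = f ^+ n.
Proof. by move=> nx; rewrite -expR_nat nx; congr expR; field. Qed.

(** The three cases for large [m] in [opt_bound_large]. All exponents are multiples of 1/50, so
    rounded powers of [f = e^(1/50)] suffice. *)
Lemma expR_numerics : [/\ 6 / 5 * expR (4 / 5) <= 269 / 100 :> R,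
  expR (98 / 100) <= 269 / 100 :> R &
  expR (162 / 100) / 2 + expR (16 / 10) / 37 <= 269 / 100 :> R].
Proof.
have [fl fu] := f_bound.
have f0 n : 0 <= f ^+ n by rewrite exprn_ge0 // expR_ge0.
have f0' : 0 <= f by exact: expR_ge0.
have f2 : f ^+ 2 <= (1041 + 23 / 1000) / 1000.
  by rewrite expr2; apply: sqr_le fu _ => //; clear; lra.
have f4 : f ^+ 4 <= (1083 + 73 / 100) / 1000.
  by rewrite (exprD f 2 2); apply: sqr_le f2 _ => //; clear; lra.
have f5 : f ^+ 5 <= (1105 + 74 / 100) / 1000.
  by rewrite exprS; apply: mul_le fu _ f4 _ => //; clear; lra.
have f10 : f ^+ 10 <= (1222 + 67 / 100) / 1000.
  by rewrite (exprD f 5 5); apply: sqr_le f5 _ => //; clear; lra.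
have f20 : f ^+ 20 <= (1494 + 93 / 100) / 1000.
  by rewrite (exprD f 10 10); apply: sqr_le f10 _ => //; clear; lra.
have f40 : f ^+ 40 <= (2234 + 82 / 100) / 1000.
  by rewrite (exprD f 20 20); apply: sqr_le f20 _ => //; clear; lra.
have f80 : f ^+ 80 <= (4994 + 43 / 100) / 1000.
  by rewrite (exprD f 40 40); apply: sqr_le f40 _ => //; clear; lra.
have f81 : f ^+ 81 <= (4000 + 1096) / 1000.
  by rewrite exprS; apply: mul_le fu _ f80 _ => //; clear; lra.
have f50 : f ^+ 50 <= (2732 + 46 / 100) / 1000.
  by rewrite (exprD f 40 10); apply: mul_le f40 _ f10 _ => //; clear; lra.
split.
- rewrite (@fX 40); last by clear; lra.
  by move: f40; move: (f ^+ 40); clear=> *; lra.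
- rewrite (@fX 49); last by clear; lra.
  (* [f^49] is obtained by dividing [f^50] by the lower bound on [f]. *)
  have : f ^+ 49 * (102 / 100) <= f ^+ 50 by rewrite (exprSr f 49); apply: ler_wpM2l.
  by move: f50; move: (f ^+ 49) (f ^+ 50); clear=> *; lra.
- rewrite (@fX 81) ?(@fX 80); try by clear; lra.
  by move: f80 f81; move: (f ^+ 80) (f ^+ 81); clear=> *; lra.
Qed.

(** [(1 + 1/j)^j] increases with [j], by AM-GM with one extra factor 1. *)
Lemma pow_ratio_mono (n d : nat) :
  (n.+2%:R / n.+1%:R) ^+ n.+1 <= ((n + d).+2%:R / (n + d).+1%:R) ^+ (n + d).+1 :> R.
Proof.
elim: d => [|d IH]; first by rewrite addn0.
apply: le_trans IH _; rewrite addnS; set j := (n + d).+1.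
have := @amgm R j 1 j.+1%:R ler01 (ler0n _ _); rewrite mul1r => /le_trans; apply.
by rewrite -[1]/(1%:R : R) -natrD add1n.
Qed.

Lemma pow_ratio_le (k : nat) : (k < 34)%N ->
  (k.+3%:R / k.+2%:R) ^+ k.+2 <= 269 / 100 :> R.
Proof.
move=> k34; apply: (@le_trans _ _ ((36 / 35) ^+ 35)).
  by have := pow_ratio_mono k.+1 (33 - k); rewrite addSn subnKC.
set a : R := 36 / 35; have a0 n : 0 <= a ^+ n by rewrite exprn_ge0 // /a; lra.
have a5 : a ^+ 5 <= (1151 + 3 / 10) / 1000.
  have a2 : a ^+ 2 <= (1057 + 96 / 100) / 1000 by rewrite /a; lra.
  have a4 : a ^+ 4 <= (1119 + 28 / 100) / 1000.
    by rewrite (exprD a 2 2); apply: sqr_le a2 _ => //; clear; lra.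
  by rewrite exprSr; apply: mul_le a4 _ (lexx a) _ => //; rewrite /a; lra.
have a10 : a ^+ 10 <= (1325 + 5 / 10) / 1000.
  by rewrite (exprD a 5 5); apply: sqr_le a5 _ => //; clear; lra.
have a15 : a ^+ 15 <= (1526 + 1 / 10) / 1000.
  by rewrite (exprD a 10 5); apply: mul_le a10 _ a5 _ => //; clear; lra.
have a30 : a ^+ 30 <= 2329 / 1000.
  by rewrite (exprD a 15 15); apply: sqr_le a15 _ => //; clear; lra.
by rewrite (exprD a 30 5); apply: mul_le a30 _ a5 _ => //; clear; lra.
Qed.

End Numerics.

(** * Consequences of the optimality condition *)

Section Optimum.
Variables (R : realType) (T : finType) (M : T -> T -> R) (k : nat).
Hypothesis M_ge0 : forall x y, 0 <= M x y.
Hypothesis M_sym : forall x y, M x y = M y x.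
Hypothesis M_diag : forall x, M x x = 0.
Hypothesis M_mass : rest_mass M [::] = 1.
Let W := walk_sum M k.+3.
Hypothesis W_opt : forall u v, u != v -> 0 < M u v ->
  k.+3%:R * W <= 2 * \sum_(i < k.+3) two_arms M u v i (k.+2 - i).

Lemma max_edge : exists u v, [/\ u != v, 0 < M u v & forall x y, M x y <= M u v].
Proof.
have [[x y] /= xy|H] := pickP (fun e : T * T => M e.1 e.2 != 0); last first.
  have /eqP := M_mass; rewrite /rest_mass big1 ?mulr0 => [|x _].
    by rewrite eq_sym oner_eq0.
  by rewrite big1 // => y _; have /negbFE/eqP := H (x, y).
pose e := [arg max_(e > (x, y)) M e.1 e.2]%O.
have Me z t : M z t <= M e.1 e.2.
  by rewrite /e; case: arg_maxP => //= e' _ /(_ (z, t) isT).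
have e0 : 0 < M e.1 e.2 by apply: lt_le_trans (Me x y); rewrite lt_neqAle eq_sym xy M_ge0.
exists e.1, e.2; split => //.
by apply: contraTneq e0 => ->; rewrite M_diag ltxx.
Qed.

Lemma opt_le (c q : R) u v : u != v -> 0 < M u v -> (forall x y, M x y <= M u v) ->
  1 <= c -> c <= 2 -> 0 <= q -> c * q = (2 - c) * M u v ->
  W / 2 <= c * ((1 - M u v + q) / k.+2%:R) ^+ k.+2.
Proof.
move=> uv p0 Mp c1 c2 q0 cq.
have := sum_two_arms_le M_ge0 M_sym M_diag M_mass k Mp c1 c2 q0 cq uv.
have := W_opt uv p0; set V := \sum_(i < _) _; set X := c * _ => H1 H2.
have : k.+3%:R * (W / 2) <= k.+3%:R * X by lra.
by rewrite ler_pM2l // ltr0n.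
Qed.

(** Taking [c = 2], [q = 0] loses nothing here: with [m = k + 3], [p >= 1/m] gives
    [(1 - p) / (m - 1) <= 1/m], hence the exact constant 2. *)
Lemma opt_le_heavy u v : u != v -> (forall x y, M x y <= M u v) ->
  1 / k.+3%:R <= M u v -> W / 2 <= 2 / k.+3%:R ^+ k.+2.
Proof.
move=> uv Mp Np.
have N0 : 0 < k.+3%:R :> R by rewrite ltr0n.
have p0 : 0 < M u v by apply: lt_le_trans Np; rewrite divr_gt0.
have c12 : 1 <= 2 :> R by rewrite ler1n.
have cq : 2 * 0 = (2 - 2) * M u v by rewrite subrr mulr0 mul0r.
have := opt_le uv p0 Mp c12 (lexx _) (lexx _) cq; rewrite addr0 => /le_trans; apply.
rewrite -exprVn; apply: ler_wpM2l => //; apply: lerXn2r; rewrite ?nnegrE ?invr_ge0 //.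
  rewrite divr_ge0 // subr_ge0; apply: le_trans (deg_ge M_ge0 u v) _.
  exact: deg_le1.
rewrite ler_pdivrMr ?ltr0n //; move: Np; rewrite div1r.
have -> : k.+2%:R = k.+3%:R - 1 :> R by rewrite -[k.+3%:R]natr1 addrK.
by rewrite mulrBr mulVf ?gt_eqF // mulr1 => Np; rewrite lerD2l lerN2.
Qed.

Lemma opt_bound_large : W / 2 * k.+3%:R ^+ k.+2 <= 269 / 100.
Proof.
have [u [v [uv p0 Mp]]] := max_edge; set p := M u v in p0 Mp.
have p1 : p <= 1 by apply: le_trans (deg_ge M_ge0 u v) (deg_le1 _ _ _ _ _).
set N : R := k.+3%:R; have N0 : 0 < N by rewrite ltr0n.
have k2E : k.+2%:R = N - 1 :> R by rewrite /N -[k.+3%:R]natr1 addrK.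
have k1E : k.+1%:R = N - 2 :> R by rewrite -[k.+1%:R](addrK 1) natr1 k2E; ring.
have Nn n : 0 <= N ^+ n by rewrite exprn_ge0 // ltW.
have [e1 e2 e3] := expR_numerics R.
(* With [m = k + 3 <= 36], the choice [c = 1], [q = p] gives [(m / (m - 1))^(m - 1)], which is still
   below 2.69, unlike its limit [e]. *)
have [k34|k34] := ltnP k 34.
  have := @opt_le 1 p u v uv p0 Mp (lexx _) ltac:(lra) (ltW p0) ltac:(rewrite /p; ring).
  rewrite subrK mul1r => /(ler_wpM2r (Nn k.+2)) /le_trans; apply.
  by rewrite -exprMn mulrAC mul1r pow_ratio_le.
have N37 : 37 <= N by rewrite /N ler_nat ltnS ltnS ltnS.
(* The choice [c = 6/5], [q = 2 p / 3] satisfies [c q = (2 - c) p] and leaves the exponent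
   [1 - N p / 3 <= 4/5]. *)
have [Np|Np] := lerP (6 / 10) (N * p).
  have := @opt_le (6 / 5) (2 / 3 * p) u v uv p0 Mp ltac:(lra) ltac:(lra) ltac:(lra)
    ltac:(rewrite /p; lra).
  move=> /(ler_wpM2r (Nn k.+2)) /le_trans; apply; apply: le_trans e1.
  rewrite -[leLHS]mulrA; apply: ler_wpM2l; first lra.
  apply: le_trans (pow_le_expR _ _ _) _; [rewrite -/p; lra|exact: ltW|].
  by rewrite ler_expR k2E -/p; lra.
have [r [Mr rmax]] : exists r : T -> R,
    (forall x y, M x y <= r x) /\ (forall x, exists y, M x y = r x).
  exists (fun x => \big[Num.max/0]_y M x y); split=> [x y|x]; first exact: le_bigmax.
  have [|y _ ->] := @eq_bigmax _ R T 0 x xpredT (M x) isT; first by move=> *;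
    exact: M_ge0.
  by exists y.
have [/forallP good|] := boolP [forall x, (deg M x != 0) ==> (2 / 100 <= N * (deg M x - 2
  * r x))].
  have sd : \sum_x deg M x = 2.
    by have H : 2^-1 * \sum_x deg M x = 1 := M_mass; lra.
  (* At each first vertex of positive degree the exponent is [1 - N (deg x - 2 r x) <= 98/100]. *)
  have : W * N ^+ k.+2 <= (\sum_x deg M x) * expR (98 / 100).
    apply: le_trans (ler_wpM2r (Nn _) (walk_sum_bound M_ge0 M_sym M_diag k.+1 Mr)) _.
    rewrite !mulr_suml; apply: ler_sum => x _; rewrite -mulrA.
    have [->|d0] := eqVneq (deg M x) 0; first by rewrite !mul0r.
    apply: ler_wpM2l; first exact: sumr_ge0.
    have rx0 : 0 <= r x := le_trans (M_ge0 x x) (Mr x x).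
    rewrite (rest_mass1 M_sym M_diag M_mass).
    apply: le_trans (pow_le_expR _ _ (ltW N0)) _.
      by have := deg_le1 M_ge0 M_sym M_diag M_mass x; lra.
    rewrite ler_expR k2E; have := good x; rewrite d0 /=; lra.
  rewrite sd; lra.
rewrite negb_forall => /existsP[x]; rewrite negb_imply -ltNge => /andP[d0 bad].
have dx1 := deg_le1 M_ge0 M_sym M_diag M_mass x.
have [z0 Mz0] : exists z, M x z != 0.
  apply/existsP; apply: contraNT d0 => /existsPn Mx0; apply/eqP.
  by apply: big1 => z _; have /negbNE/eqP := Mx0 z.
have r0 : 0 < r x by apply: lt_le_trans (Mr x z0); rewrite lt_neqAle eq_sym Mz0 M_ge0.
have [y yr] := rmax x.
have xy : x != y by apply: contraTneq r0 => xy; rewrite -yr xy M_diag ltxx.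
have Mp' : forall z t, M z t <= p := Mp.
(* Optimality is applied to the heaviest edge [xy] at the bad vertex [x]. All positions but one are
   explored from [x] and give [a1]; the remaining [a2] enters only with weight [1/N]. *)
have := sum_two_arms_bound M_ge0 M_sym M_diag M_mass k Mp' (lexx 1) ltac:(lra) (ltW p0)
  ltac:(ring) xy.
have := W_opt xy; rewrite yr => /(_ r0); set V := \sum_(i < _) _ => H1 H2.
set d := deg M x in d0 bad dx1 H2.
set a1 := arm_value _ _ _ _ d in H2; set a2 := arm_value _ _ _ _ _ in H2.
have rd : r x <= d by rewrite -yr deg_ge.
have rp : r x <= p by rewrite -yr.
have A2 : a2 * N ^+ k.+2 <= expR (16 / 10).
  have : a2 <= 1 * ((1 - M x y + p) / k.+2%:R) ^+ k.+2.
    rewrite /a2 -yr; apply: arm_value_le => //; first exact: ltW.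
    by rewrite M_sym deg_ge.
  rewrite mul1r => /(ler_wpM2r (Nn k.+2)) /le_trans; apply.
  apply: le_trans (pow_le_expR _ _ (ltW N0)) _; first by rewrite yr; lra.
  rewrite ler_expR k2E yr; have := mulr_ge0 (ltW N0) (ltW r0); lra.
(* With [s = N (d - r)] this uses [s e^(-2s) <= 1 / (2e)]. *)
have A1 : a1 * N ^+ k.+2 <= expR (162 / 100) / 2.
  rewrite /a1 /arm_value mul1r [N ^+ k.+2]exprS.
  set s := N * (d - r x); have s0 : 0 <= s.
    by apply: mulr_ge0; [exact: ltW|rewrite subr_ge0].
  have -> (X Y : R) : (d - r x) * X * (N * Y) = s * (X * Y) by rewrite /s; ring.
  (* The exponent is [2 - N d + N p], with [N p < 0.6] and [N d < 2 N r + 0.02]. *)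
  apply: (@le_trans _ _ (s * expR (262 / 100 - 2 * s))).
    apply: ler_wpM2l => //; apply: le_trans (pow_le_expR _ _ (ltW N0)) _; first by lra.
    rewrite ler_expR k1E /s; lra.
  have -> : 262 / 100 - 2 * s = 162 / 100 + (- (2 * s - 1)) by lra.
  rewrite expRD mulrCA; apply: ler_wpM2l; first exact: expR_ge0.
  have := expR_ge1Dx (2 * s - 1); rewrite expRN => H.
  rewrite ler_pdivrMr ?expR_gt0 //; lra.
have a10 : 0 <= a1 * N ^+ k.+2.
  rewrite mulr_ge0 // /a1 /arm_value mul1r mulr_ge0 ?subr_ge0 // exprn_ge0 // divr_ge0
    //; lra.
have : N * (W / 2 * N ^+ k.+2) <= N * (expR (162 / 100) / 2) + expR (16 / 10).
  have H : N * (W / 2) <= (N - 1) * a1 + a2 by rewrite -k2E; move: H1; rewrite -/N; lra.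
  have := ler_wpM2r (Nn k.+2) H; move: (N ^+ k.+2) A1 A2 a10 => Z A1 A2 a10.
  have := ler_wpM2l (ltW N0) A1; lra.
move: e3; set E1 := expR _; set E2 := expR _ => e3 H.
have E20 : 0 <= E2 := expR_ge0 _.
rewrite -(ler_pM2l N0); apply: le_trans H _.
have := ler_wpM2l (ltW N0) e3; have := ler_wpM2r E20 N37; lra.
Qed.

End Optimum.

(** * Existence of an optimal weight *)

Definition edge_weight (R : realFieldType) (T : finType) (M : T -> T -> R) : Prop :=
  [/\ forall x y, 0 <= M x y, forall x y, M x y = M y x, forall x, M x x = 0
    & rest_mass M [::] = 1].

Lemma walk_sum_scale (R : realFieldType) (T : finType) (M : T -> T -> R) (c : R) m :
  walk_sum (fun x y => c * M x y) m = c ^+ m * walk_sum M m.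
Proof.
have pwZ s x : pw (fun x y => c * M x y) x s = c ^+ size s * pw M x s.
  by elim: s x => [|y s IH] x /=; rewrite ?expr0 ?mul1r // IH exprS; ring.
rewrite /walk_sum -sumwZ; apply: eq_sumw => -[//|x s] [sm].
by rewrite /pwl pwZ sm; ring.
Qed.

Lemma shrink_mass (R : realFieldType) (T : finType) (M : T -> T -> R) u v (t : R) :
  u != v -> (forall x y, M x y = M y x) ->
  rest_mass (shrink M u v t) [::] = rest_mass M [::] - t * M u v.
Proof.
move=> uv Ms.
have pick a b : \sum_x \sum_y M x y * ((x == a) && (y == b))%:R = M a b.
  rewrite (bigD1 a) //= [X in _ + X]big1 ?addr0 => [|x /negPf xa]; last first.
    by rewrite big1 // => y _; rewrite xa mulr0.
  rewrite (bigD1 b) //= !eqxx mulr1 [X in _ + X]big1 ?addr0 // => y /negPf yb.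
  by rewrite yb andbF mulr0.
have E : \sum_x \sum_y M x y * ((x == u) && (y == v) || (x == v) && (y == u))%:R = 2 * M
  u v.
  have -> : 2 * M u v = M u v + M v u by rewrite (Ms v u); ring.
  rewrite -(pick u v) -(pick v u) -big_split; apply: eq_bigr => x _ /=.
  rewrite -big_split; apply: eq_bigr => y _ /=; rewrite -mulrDr; congr (_ * _).
  case: (x =P u) => [->|_] /=; last by rewrite add0r.
  by rewrite (negPf uv) /= orbF addr0.
rewrite /rest_mass.
have -> : t * M u v = 2^-1 * (t * (2 * M u v)) by field.
rewrite -E -mulrBr; congr (_ * _); rewrite mulr_sumr -sumrB; apply: eq_bigr => x _.
by rewrite mulr_sumr -sumrB; apply: eq_bigr => y _; rewrite /shrink; ring.
Qed.

Lemma shrink_sym (R : realFieldType) (T : finType) (M : T -> T -> R) u v (t : R) :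
  (forall x y, M x y = M y x) -> forall x y, shrink M u v t x y = shrink M u v t y x.
Proof. by move=> Ms x y;
  rewrite /shrink Ms orbC [(x == v) && _]andbC [(x == u) && _]andbC. Qed.

(** Dividing the shrunk weight by its mass [1 - t M u v] gives a competitor; by homogeneity this
    factor moves to the other side as a power. *)
Lemma maximizer_optimality (R : realFieldType) (T : finType) (M : T -> T -> R) k :
  edge_weight M -> (forall M' : T -> T -> R, edge_weight M' -> walk_sum M' k.+1 <=
    walk_sum M k.+1) ->
  forall u v, u != v -> 0 < M u v ->
    k.+1%:R * walk_sum M k.+1 <= 2 * \sum_(i < k.+1) two_arms M u v i (k - i).
Proof.
move=> [M0 Ms Md Mm] Mmax u v uv p0; apply: optimality => //.
  apply: sumw_ge0 => -[|x s]; first by rewrite mulr1 chi_ge0.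
  by rewrite mulr_ge0 ?chi_ge0 ?pw_ge0.
move=> t t0 t2 tp; set z := 1 - t * M u v; have z0 : 0 < z by rewrite /z; lra.
have zV : z * z^-1 = 1 by rewrite mulfV // gt_eqF.
pose M' x y := z^-1 * shrink M u v t x y.
have : edge_weight M'.
  split=> [x y|x y|x|].
  - apply: mulr_ge0; first by rewrite invr_ge0 ltW.
    apply: mulr_ge0 => //; case: (_ || _); rewrite ?mulr0 ?mulr1; lra.
  - by rewrite /M' shrink_sym.
  - by rewrite /M' /shrink Md mul0r mulr0.
  - rewrite /rest_mass; under eq_bigr do rewrite -mulr_sumr.
    by rewrite -mulr_sumr mulrCA -/(rest_mass _ _) shrink_mass // Mm -/z mulrC.
move=> /Mmax; rewrite walk_sum_scale exprVn ler_pdivrMl ?exprn_gt0 //.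
by rewrite mulrC.
Qed.

Section Maximizer.
Import numFieldNormedType.Exports.
Local Open Scope classical_set_scope.
Local Open Scope ring_scope.

Variables (R : realType) (T : finType).
Let n := #|{: T * T}|.
(** Weights are flattened to row vectors, for which compactness of cubes is available. *)
Let wt (w : 'rV[R]_n) (x y : T) : R := w ord0 (enum_rank (x, y)).

Local Lemma continuous_mul (f g : 'rV[R]_n -> R) :
  continuous f -> continuous g -> continuous (fun w => f w * g w).
Proof. by move=> cf cg w; exact: (continuousM (cf w) (cg w)). Qed.

Local Lemma continuous_add (f g : 'rV[R]_n -> R) :
  continuous f -> continuous g -> continuous (fun w => f w + g w).
Proof. by move=> cf cg w; exact: (continuousD (cf w) (cg w)). Qed.

Local Lemma continuous_const (c : R) : continuous (fun _ : 'rV[R]_n => c).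
Proof. by move=> w; exact: cst_continuous. Qed.

Local Lemma continuous_bigsum (I : Type) (r : seq I) (F : I -> 'rV[R]_n -> R) :
  (forall i, continuous (F i)) -> continuous (fun w => \sum_(i <- r) F i w).
Proof.
move=> cF; elim: r => [|i r IH].
  rewrite (_ : (fun _ => _) = fun=> 0); first exact: continuous_const.
  by apply/funext => w; rewrite big_nil.
rewrite (_ : (fun _ => _) = fun w => F i w + \sum_(j <- r) F j w).
  exact: continuous_add.
by apply/funext => w; rewrite big_cons.
Qed.

Local Lemma continuous_wt x y : continuous (fun w => wt w x y).
Proof. exact: coord_continuous. Qed.

Local Lemma continuous_walk_sum m : continuous (fun w => walk_sum (wt w) m).
Proof.
have cpw s x : continuous (fun w => pw (wt w) x s).
  elim: s x => [|y s IH] x; first exact: continuous_const.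
  by apply: continuous_mul; [exact: continuous_wt|exact: IH].
have cs k (F : 'rV[R]_n -> seq T -> R) : (forall s, continuous (F^~ s)) ->
    continuous (fun w => sumw k (F w)).
  elim: k F => [|k IH] F cF; first exact: cF.
  by apply: continuous_bigsum => x; apply: IH => s; exact: cF.
apply: cs => s; apply: continuous_mul; first exact: continuous_const.
by case: s => [|x s]; [exact: continuous_const|exact: cpw].
Qed.

(* All equality constraints on an edge weight, as the vanishing of one sum of squares. *)
Let defect (w : 'rV[R]_n) : R :=
  \sum_x \sum_y (wt w x y - wt w y x) ^+ 2 + \sum_x wt w x x ^+ 2
  + (rest_mass (wt w) [::] - 1) ^+ 2.

Local Lemma continuous_defect : continuous defect.
Proof.
have csub (f g : 'rV[R]_n -> R) : continuous f -> continuous g ->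
    continuous (fun w => f w - g w).
  by move=> cf cg w; exact: (continuousB (cf w) (cg w)).
have csqr (f : 'rV[R]_n -> R) : continuous f -> continuous (fun w => f w ^+ 2).
  by move=> cf; exact: continuous_mul.
apply: continuous_add; first apply: continuous_add.
- apply: continuous_bigsum => x; apply: continuous_bigsum => y; apply: csqr.
  by apply: csub; exact: continuous_wt.
- by apply: continuous_bigsum => x; apply: csqr; exact: continuous_wt.
apply: csqr; apply: csub; last exact: continuous_const.
apply: continuous_mul; first exact: continuous_const.
rewrite (_ : (fun _ => _) = fun w => \sum_x \sum_y wt w x y); last first.
  by apply/funext => w; apply: eq_bigr => x _; apply: eq_bigl.
by apply: continuous_bigsum => x; apply: continuous_bigsum => y; exact: continuous_wt.
Qed.

Local Lemma defect_eq0 w : defect w = 0 -> [/\ forall x y, wt w x y = wt w y x,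
  forall x, wt w x x = 0 & rest_mass (wt w) [::] = 1].
Proof.
have s1 : 0 <= \sum_x \sum_y (wt w x y - wt w y x) ^+ 2.
  by apply: sumr_ge0 => x _; apply: sumr_ge0 => y _; exact: sqr_ge0.
have s2 : 0 <= \sum_x wt w x x ^+ 2 by apply: sumr_ge0 => x _; exact: sqr_ge0.
move/eqP; rewrite /defect paddr_eq0 ?sqr_ge0 ?addr_ge0 // paddr_eq0 //.
move=> /andP[/andP[d1 d2] d3]; split.
- move=> x y; apply/eqP; rewrite -subr_eq0 -sqrf_eq0.
  move: d1; rewrite psumr_eq0 => [/allP/(_ x)|z _]; last by apply: sumr_ge0 => t _;
    exact: sqr_ge0.
  rewrite mem_index_enum => /(_ isT); rewrite /= psumr_eq0 => [/allP/(_ y)|z _];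
    last exact: sqr_ge0.
  by rewrite mem_index_enum => /(_ isT).
- move=> x; apply/eqP; rewrite -sqrf_eq0.
  move: d2; rewrite psumr_eq0 => [/allP/(_ x)|z _]; last exact: sqr_ge0.
  by rewrite mem_index_enum => /(_ isT).
- by apply/eqP; rewrite -subr_eq0 -sqrf_eq0.
Qed.

(** Total mass 1 keeps all entries in [[0, 1]], so the weights form a closed part of a cube,
    nonempty because of [M0]. *)
Lemma exists_maximizer (M0 : T -> T -> R) m : edge_weight M0 ->
  exists M : T -> T -> R, edge_weight M /\
    forall M' : T -> T -> R, edge_weight M' -> walk_sum M' m <= walk_sum M m.
Proof.
move=> eM0.
pose K := [set w : 'rV[R]_n | forall i, `[0, 1]%classic (w ord0 i)] `&` defect @^-1` [set
  0].
pose row (M : T -> T -> R) : 'rV[R]_n := \row_i M (enum_val i).1 (enum_val i).2.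
have wtK M : wt (row M) = M.
  by apply/funext => x; apply/funext => y; rewrite /wt mxE enum_rankK.
have rowK M : edge_weight M -> K (row M).
  move=> eM; have [Mge Ms Md Mm] := eM; split.
    move=> i; rewrite /= mxE in_itv /= Mge /=.
    exact: le_trans (deg_ge Mge _ _) (deg_le1 Mge Ms Md Mm _).
  rewrite /= /defect wtK Mm subrr expr0n addr0 !big1 ?addr0 // => x _.
    by rewrite Md expr0n.
  by rewrite big1 // => y _; rewrite Ms subrr expr0n.
have cK : compact K.
  apply: compact_closedI; first by apply: (@rV_compact R n (fun=> `[0, 1]%classic)) => i;
    exact: segment_compact.
  by apply: preimage_closed; [move=> w _; exact: continuous_defect|exact: closed_eq].
have [w wK wmax] := @compact_EVT_max _ R (fun w => walk_sum (wt w) m) K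
  (ex_intro _ _ (rowK _ eM0)) cK (continuous_subspaceT (@continuous_walk_sum m)).
exists (wt w); have := set_mem wK => -[w0 /defect_eq0[ws wd wm]]; split.
  split=> // x y; have := w0 (enum_rank (x, y)); rewrite /= in_itv /=.
  by case/andP.
move=> M' eM'; rewrite -[M' in leLHS]wtK; apply: wmax; exact/mem_set/rowK.
Qed.

End Maximizer.

(** It suffices to treat weights satisfying the first-order condition: a maximiser on the same
    vertex set is one, and it dominates [M0]. *)
Lemma walk_sum_le (R : realType) (T : finType) (M0 : T -> T -> R) k (b : R) :
  edge_weight M0 ->
  (forall M : T -> T -> R, edge_weight M ->
     (forall u v, u != v -> 0 < M u v ->
        k.+1%:R * walk_sum M k.+1 <= 2 * \sum_(i < k.+1) two_arms M u v i (k - i)) ->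
     walk_sum M k.+1 / 2 <= b) ->
  walk_sum M0 k.+1 / 2 <= b.
Proof.
move=> eM0 H; have [M [eM Mmax]] := exists_maximizer k.+1 eM0.
have := H M eM (maximizer_optimality eM Mmax); apply: le_trans.
by rewrite ler_pM2r ?invr_gt0 // Mmax.
Qed.

Section WalkSumBounds.
Variables (R : realType) (T : finType) (M : T -> T -> R).
Hypothesis eM : edge_weight M.

Lemma walk_sum3 : walk_sum M 3 / 2 <= 2 / 3 ^+ 2.
Proof.
apply: walk_sum_le eM _ => M' [M0 Ms Md Mm] opt.
have [u [v [uv p0 Mp]]] := max_edge M0 Md Mm.
have [Np|/ltW Np] := lerP (1 / 3) (M' u v);
  first exact: (opt_le_heavy M0 Ms Md Mm opt uv Mp Np).
have := three_arms_bound M0 Ms Md Mm uv Mp Np.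
have := opt u v uv p0; set V := \sum_(i < _) _ => H1 H2; lra.
Qed.

Lemma walk_sum4 : walk_sum M 4 / 2 <= 2 / 4 ^+ 3.
Proof.
apply: walk_sum_le eM _ => M' [M0 Ms Md Mm] opt.
have [u [v [uv p0 Mp]]] := max_edge M0 Md Mm.
have [Np|/ltW Np] := lerP (1 / 4) (M' u v);
  first exact: (opt_le_heavy M0 Ms Md Mm opt uv Mp Np).
have := four_arms_bound M0 Ms Md Mm uv Mp Np.
have := opt u v uv p0; set V := \sum_(i < _) _ => H1 H2; lra.
Qed.

Lemma walk_sum_large k : walk_sum M k.+3 / 2 <= (269 / 100) / k.+3%:R ^+ k.+2.
Proof.
apply: walk_sum_le eM _ => M' [M0 Ms Md Mm] opt.
by rewrite ler_pdivlMr ?exprn_gt0 ?ltr0n //; exact: (opt_bound_large M0 Ms Md Mm opt).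
Qed.

End WalkSumBounds.

(** * Copies of paths and cycles as walks *)

Section BetaBounds.
Variables (R : realType) (n : nat) (mu : {ffun {set 'I_n} -> R}).
Hypothesis mu_epm : is_epm mu.

Let M (x y : 'I_n) : R := mu [set x; y].

Local Lemma mu_ge0 e : 0 <= mu e. Proof. by case: mu_epm. Qed.

Lemma mu_sub_ge0 F : 0 <= mu_sub mu F.
Proof. by apply: prodr_ge0 => e _; exact: mu_ge0. Qed.

Lemma beta_ge0 h (EH : {set {set 'I_h}}) : 0 <= beta mu EH.
Proof. by apply: sumr_ge0 => VF _; exact: mu_sub_ge0. Qed.

Lemma sum_Kedges (F : {set 'I_n} -> R) :
  \sum_x \sum_(y | y != x) F [set x; y] = 2 * \sum_(e in Kedges n) F e.
Proof.
rewrite pair_big_dep /=.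
rewrite (partition_big (fun p : 'I_n * 'I_n => [set p.1;
  p.2]) (fun e => e \in Kedges n)) /=; last first.
  by move=> [x y] /= xy; rewrite inE cards2 [x == y]eq_sym xy.
rewrite mulr_sumr; apply: eq_bigr => e; rewrite inE => /cards2P[a [b [ab ->]]].
rewrite (bigD1 (a, b)) /=; last by rewrite [b == a]eq_sym ab eqxx.
rewrite (bigD1 (b, a)) /=;
  last by rewrite ab finset.setUC eqxx xpair_eqE negb_and [b == a]eq_sym ab.
rewrite big1 => [|[x y] /=]; first by rewrite addr0 [[set b; a]]finset.setUC; ring.
rewrite !xpair_eqE => /andP[/andP[/andP[yx /eqP eE] h1] h2]; exfalso.
have : x \in [set a; b] by rewrite -eE set21.
have : y \in [set a; b] by rewrite -eE set22.
rewrite !inE => /orP[] /eqP yE /orP[] /eqP xE; subst x y; move: yx h1 h2;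
  by rewrite !eqxx.
Qed.

Local Lemma M_diag x : M x x = 0.
Proof. by case: mu_epm => _ H _; rewrite /M finset.setUid H // inE cards1. Qed.

Lemma epm_edge_weight : edge_weight M.
Proof.
split=> [x y|x y|x|]; [exact: mu_ge0|by rewrite /M finset.setUC|exact: M_diag|].
rewrite /rest_mass -[\sum_(x | _) _]/(\sum_x \sum_y M x y).
have -> : \sum_x \sum_y M x y = \sum_x \sum_(y | y != x) mu [set x; y].
  by apply: eq_bigr => x _; rewrite (bigD1 x) //= M_diag add0r.
by rewrite sum_Kedges; case: mu_epm => _ _ ->; rewrite mulr1 mulVf // pnatr_eq0.
Qed.

(* Every copy of H is the image of at least as many injections as there are
   automorphisms of H in the family [g]. *)
Lemma beta_aut_le h (EH : {set {set 'I_h}}) (I : finType) (g : I -> {ffun 'I_h -> 'I_h}) :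
  injective g -> (forall i, injective (g i)) ->
  (forall i, [set g i @: (e : {set 'I_h}) | e in EH] = EH) ->
  #|I|%:R * beta mu EH <= \sum_(f : {ffun 'I_h -> 'I_n} | injectiveb f)
    mu_sub mu [set f @: (e : {set 'I_h}) | e in EH].
Proof.
move=> gI gi gE.
rewrite (partition_big (fun f : {ffun 'I_h -> 'I_n} =>
   (f @: [set: 'I_h], [set f @: (e : {set 'I_h}) | e in EH])) (iso_sub EH)); last first.
  by move=> f fi; apply/existsP; exists f; rewrite fi !eqxx.
rewrite /beta mulr_sumr; apply: ler_sum => -[V F] /existsP[f /and3P[fi /eqP VE /eqP FE]].
rewrite /= in VE FE.
rewrite (eq_bigr (fun=> mu_sub mu F)); last by move=> f' /andP[_ /eqP[_ ->]].
rewrite sumr_const -[leRHS]mulr_natl; apply: ler_wpM2r; first exact: mu_sub_ge0.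
rewrite ler_nat.
(* Composing one embedding with the automorphisms gives [#|I|] distinct embeddings with the same
   image. *)
pose fg i : {ffun 'I_h -> 'I_n} := [ffun x => f (g i x)].
have finj := injectiveP _ fi.
have fgI : injective fg.
  move=> i j /ffunP fgij; apply: gI; apply/ffunP => x; apply: finj.
  by have := fgij x; rewrite !ffunE.
rewrite -(card_imset _ fgI); apply: subset_leq_card;
  apply/fintype.subsetP => _ /imsetP[i _ ->].
have imE (A : {set 'I_h}) : fg i @: A = f @: (g i @: A).
  by rewrite -imset_comp; apply: eq_imset => x; rewrite /= ffunE.
rewrite unfold_in; apply/andP; split.
  by apply/injectiveP => x y; rewrite !ffunE => /finj /gi.
rewrite xpair_eqE; apply/andP; split.
  have gT : g i @: [set: 'I_h]%SET = [set: 'I_h]%SET.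
    apply/finset.setP => x; rewrite !inE; have [g' _ g'K] := injF_bij (gi i).
    by apply/imsetP; exists (g' x); rewrite ?inE ?g'K.
  by rewrite VE imE gT.
apply/eqP; rewrite FE -{2}(gE i) -imset_comp; apply: eq_imset => e /=.
exact: imE.
Qed.

Lemma sumw_ffun (T : finType) k (F : seq T -> R) :
  \sum_(f : {ffun 'I_k -> T}) F [seq f i | i <- enum 'I_k] = sumw k F.
Proof.
rewrite (reindex (fun t : k.-tuple T => [ffun i => tnth t i])) /=; last first.
  exists (fun f : {ffun 'I_k -> T} => mktuple f) => [t _|f _].
    by apply: eq_from_tnth => i; rewrite tnth_mktuple ffunE.
  by apply/ffunP => i; rewrite ffunE tnth_mktuple.
have -> : \sum_(t : k.-tuple T) F [seq [ffun i => tnth t i] i | i <- enum 'I_k]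
    = \sum_(t : k.-tuple T) F t.
  apply: eq_bigr => t _; congr F; rewrite -[RHS]map_tnth_enum.
  by apply: eq_map => i; rewrite ffunE.
elim: k F => [|k IH] F /=.
  rewrite (big_pred1 [tuple]) // => t /=.
  by apply/esym/eqP; exact: tuple0.
rewrite (reindex (fun p : T * k.-tuple T => [tuple of p.1 :: p.2])) /=; last first.
  exists (fun t : k.+1.-tuple T => (thead t, [tuple of behead t])) => [[x t] _|t _] /=.
    by rewrite theadE; congr (_, _); apply: val_inj.
  by rewrite -tuple_eta.
rewrite -(pair_big xpredT xpredT (fun x (t : k.-tuple T) => F (x :: t))) /=.
by apply: eq_bigr => x _; rewrite -IH.
Qed.

Lemma pwlE (x0 : 'I_n) s : pwl M s = \prod_(i < (size s).-1) M (nth x0 s i) (nth x0 s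
  i.+1).
Proof.
case: s => [|x s]; first by rewrite big_ord0.
rewrite /pwl /=; elim: s x => [|y s IH] x; first by rewrite big_ord0.
by rewrite /= big_ord_recl /= IH.
Qed.

Lemma mu_sub_prod h (f : {ffun 'I_h -> 'I_n}) (I : finType) (E : I -> {set 'I_h})
    (a b : I -> 'I_h) : injective f -> injective E -> (forall i, E i = [set a i; b i]) ->
  mu_sub mu [set f @: (e : {set 'I_h}) | e in [set E i | i : I]] = \prod_i M (f (a i)) (f
    (b i)).
Proof.
move=> fi Ei EE; rewrite -imset_comp /mu_sub big_imset /=.
  by apply: eq_bigr => i _; rewrite EE imsetU1 imset_set1.
by move=> i j _ _ /= /(imset_inj fi) /Ei.
Qed.

Lemma nth_map_enum h (f : {ffun 'I_h -> 'I_n}) x0 (j : 'I_h) :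
  nth x0 [seq f i | i <- enum 'I_h] j = f j.
Proof. by rewrite (nth_map j) ?size_enum_ord // nth_ord_enum. Qed.

Let path_edge k (i : 'I_k) : {set 'I_k.+1} := [set widen_ord (leqnSn k) i; lift ord0 i].

Local Lemma path_edge_inj k : injective (@path_edge k).
Proof.
move=> i j ij; apply: val_inj.
have h1 : widen_ord (leqnSn k) j \in path_edge i by rewrite ij set21.
have h2 : widen_ord (leqnSn k) i \in path_edge j by rewrite -ij set21.
move: h1 h2; rewrite !inE => /orP[] /eqP /(congr1 val) /= h1 /orP[] /eqP /(congr1 val) /=.
all: by move: h1; rewrite /bump /=; lia.
Qed.

Local Lemma P_edgesE k : P_edges k.+1 = [set path_edge i | i : 'I_k].
Proof.
apply/finset.setP => e; rewrite inE;
  apply/existsP/imsetP => [[i /existsP[j /andP[/eqP -> /eqP ji]]]|[i _ ->]].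
  have ik : (i < k)%N by have := ltn_ord j; rewrite ji ltnS.
  exists (Ordinal ik) => //; congr [set _; _]; exact: val_inj.
exists (widen_ord (leqnSn k) i); apply/existsP; exists (lift ord0 i).
by rewrite eqxx /= /bump add1n.
Qed.

Lemma P_beta_le k : 2 * beta mu (P_edges k.+2) <=
  sumw k.+2 (fun s => if uniq s then pwl M s else 0).
Proof.
(* The identity and the reversal, which differ because there are at least two vertices. *)
pose g (b : bool) : {ffun 'I_k.+2 -> 'I_k.+2} := [ffun i => if b then rev_ord i else i].
have gI : injective g.
  by move=> [] [] // /ffunP /(_ ord0); rewrite !ffunE => /(congr1 val).
have gi b : injective (g b).
  by case: b => i j; rewrite !ffunE // => /rev_ord_inj.
have gE b : [set g b @: (e : {set 'I_k.+2}) | e in P_edges k.+2] = P_edges k.+2.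
  rewrite P_edgesE -imset_comp.
  case: b; last first.
    apply: eq_imset => i /=; rewrite -[RHS]imset_id; apply: eq_imset => x.
    by rewrite ffunE.
  have E i : g true @: path_edge i = path_edge (rev_ord i).
    rewrite /path_edge imsetU1 imset_set1 !ffunE finset.setUC.
    by congr [set _; _]; apply: val_inj; rewrite /= /bump /=; have := ltn_ord i; lia.
  apply/finset.setP => e; apply/imsetP/imsetP => [[i _ ->]|[i _ ->]];
    exists (rev_ord i) => //=.
  by rewrite E rev_ordK.
have := beta_aut_le gI gi gE; rewrite card_bool => /le_trans; apply.
rewrite -sumw_ffun big_mkcond /=; apply: ler_sum => f _.
rewrite -[uniq _]/(injectiveb f); case: ifP => // /injectiveP fi.
rewrite P_edgesE (mu_sub_prod fi (@path_edge_inj _) (fun=> erefl)) (pwlE (f ord0)).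
rewrite size_map size_enum_ord le_eqVlt; apply/orP; left; apply/eqP.
apply: eq_bigr => i _; congr (M _ _); first by rewrite -(nth_map_enum f (f ord0)).
by rewrite -(nth_map_enum f (f ord0)) /= /bump add1n.
Qed.

Let cycle_edge k (i : 'I_k.+3) : {set 'I_k.+3} := [set i; ordS i].

Local Lemma val_ordS k (i : 'I_k.+3) : ordS i = (if i == k.+2 :> nat then 0 else i.+1) :>
  nat.
Proof.
rewrite /=; case: eqP => [->|ik]; first by rewrite modnn.
by rewrite modn_small //; have := ltn_ord i; lia.
Qed.

Local Lemma ordS_add1 k (i : 'I_k.+3) : ordS i = (i + 1)%R.
Proof. by apply: val_inj; rewrite /= modnDmr addn1. Qed.

Local Lemma cycle_edge_inj k : injective (@cycle_edge k).
Proof.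
move=> i j ij; apply: val_inj.
have h1 : j \in cycle_edge i by rewrite ij set21.
have h2 : i \in cycle_edge j by rewrite -ij set21.
move: h1 h2; rewrite !inE => /orP[/eqP -> //|/eqP h1] /orP[/eqP -> //|/eqP h2].
have := val_ordS i; have := val_ordS j; rewrite -h1 -h2.
by have := ltn_ord i; have := ltn_ord j; do 2?case: eqP; lia.
Qed.

Local Lemma C_edgesE k : C_edges k.+3 = [set cycle_edge i | i : 'I_k.+3].
Proof.
apply/finset.setP => e; rewrite inE;
  apply/existsP/imsetP => [[i /existsP[j /andP[/eqP -> /eqP ji]]]|[i _ ->]].
  by exists i => //; congr [set _; _]; exact: val_inj.
by exists i; apply/existsP; exists (ordS i); rewrite !eqxx.
Qed.

Lemma C_beta_le k : 2 * k.+3%:R * beta mu (C_edges k.+3) <=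
  sumw k.+3 (fun s => if s is x :: s' then if uniq s then pw M x (rcons s' x) else 0 else
    0).
Proof.
(* The [2m] rotations and reflections of the integers modulo [m = k + 3]; a rotation is never a
   reflection because [2] is not zero modulo [m]. *)
pose g (bj : bool * 'I_k.+3) : {ffun 'I_k.+3 -> 'I_k.+3} :=
  [ffun i => if bj.1 then (bj.2 - i)%R else (bj.2 + i)%R].
have gI : injective g.
  move=> [b j] [b' j'] /ffunP gg; have := gg 0; have := gg 1; rewrite !ffunE /=.
  rewrite !subr0 !addr0 !if_same => + jj; rewrite {}jj.
  have two : (1 + 1 : 'I_k.+3) != 0 by rewrite -val_eqE.
  case: b b' {gg} => [] [] // /addrI h; case/eqP: two.
    by rewrite -[X in X + _]h addNr.
  by rewrite [X in X + _]h addNr.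
have gi bj : injective (g bj).
  case: bj => [[] j] i i'; rewrite !ffunE /= => /addrI //.
  exact: oppr_inj.
have E bj i : g bj @: cycle_edge i =
    cycle_edge (if bj.1 then (bj.2 - i - 1)%R else (bj.2 + i)%R).
  rewrite /cycle_edge imsetU1 imset_set1 !ffunE !ordS_add1; case: (bj.1).
    by rewrite finset.setUC opprD addrA subrK.
  by rewrite addrA.
have gE bj : [set g bj @: (e : {set 'I_k.+3}) | e in C_edges k.+3] = C_edges k.+3.
  rewrite C_edgesE -imset_comp; apply/finset.setP => e;
    apply/imsetP/imsetP => [[i _ ->]|[i _ ->]].
    by eexists; last exact: E.
  exists (if bj.1 then (bj.2 - i - 1)%R else (i - bj.2)%R) => //=; rewrite E.
  congr cycle_edge; case: (bj.1); last by rewrite addrCA subrr addr0.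
  by rewrite -[RHS]addrA -opprD subrK opprB addrC subrK.
have := beta_aut_le gI gi gE; rewrite card_prod card_bool card_ord natrM => /le_trans;
  apply.
rewrite -sumw_ffun big_mkcond /=; apply: ler_sum => f _.
have [x [s' fE]] : exists x s', [seq f i | i <- enum 'I_k.+3] = x :: s'.
  by case E' : [seq _ | _ <- _] => [|x s']; [move/(congr1 size): E';
    rewrite size_map size_enum_ord|exists x, s'].
have xE : x = f ord0 by rewrite -(nth_map_enum f x ord0) fE.
rewrite fE -fE -[uniq _]/(injectiveb f); case: ifP => // /injectiveP fi.
rewrite C_edgesE (mu_sub_prod fi (@cycle_edge_inj _) (fun=> erefl)).
rewrite -[pw _ _ _]/(pwl M (rcons (x :: s') x)) -fE (pwlE x) size_rcons size_map
  size_enum_ord.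
rewrite le_eqVlt; apply/orP; left; apply/eqP.
(* The default value [x] of [nth] is the first vertex, so reading one place past the end closes the
   cycle. *)
have nthr j : nth x (rcons [seq f i | i <- enum 'I_k.+3] x) j = nth x [seq f i | i <-
  enum 'I_k.+3] j.
  by rewrite nth_rcons; case: ltnP => // /(nth_default x) ->; rewrite if_same.
apply: eq_bigr => i _; rewrite !nthr nth_map_enum; congr (M _ _).
have vS := val_ordS i; have [ik|ik] := eqVneq (i : nat) k.+2.
  have -> : nth x [seq f i | i <- enum 'I_k.+3] i.+1 = x.
    by apply: nth_default; rewrite size_map size_enum_ord ik.
  by rewrite {1}xE; congr (f _); apply: ord_inj; rewrite vS ik eqxx.
by rewrite -(nth_map_enum f x) vS (negPf ik).
Qed.

Lemma walk_sum_split k : walk_sum M k.+1 =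
  2 * sumw k.+1 (fun s => if s is x :: s' then if uniq s then pw M x (rcons s' x) else 0
    else 0)
  + sumw k.+2 (fun s => if uniq s then pwl M s else 0).
Proof.
rewrite /walk_sum !(sumw_rcons k.+1) -!sumw_sum -sumwZ -sumwD;
  apply: eq_sumw => -[//|x s] _.
rewrite (chi_sum x s (fun y => pwl M (rcons (x :: s) y))).
have -> : \sum_y (if uniq (rcons (x :: s) y) then pwl M (rcons (x :: s) y) else 0) =
    if uniq (x :: s) then \sum_(y | y \notin x :: s) pwl M (rcons (x :: s) y) else 0.
  case: ifPn => us; last by rewrite big1 // => y _; rewrite rcons_uniq (negPf us) andbF.
  by rewrite [RHS]big_mkcond; apply: eq_bigr => y _; rewrite rcons_uniq us andbT.
by case: ifP => _; rewrite ?mulr0 ?addr0.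
Qed.

Lemma cycle_path_beta_le k :
  2 * k.+3%:R * beta mu (C_edges k.+3) + beta mu (P_edges k.+4) <= walk_sum M k.+3 / 2.
Proof.
rewrite ler_pdivlMr // walk_sum_split.
have := C_beta_le k; have := P_beta_le k.+2; set S1 := sumw _ _; set S2 := sumw _ _; lra.
Qed.

(** With [q] the sum of the squared masses, [sum_deg_sqr] gives [2 beta <= 1 - q], and
    [2 q + (1 - q) / 2 <= 2] because [q <= 1]. *)
Lemma square_path_beta_le :
  2 * (\sum_(e | 0 < mu e) mu e ^+ 2) + beta mu (P_edges 3) <= 2.
Proof.
have [M0 Ms Md Mm] := epm_edge_weight.
pose q := 2^-1 * \sum_x \sum_y M x y ^+ 2.
have -> : \sum_(e | 0 < mu e) mu e ^+ 2 = q.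
  have -> : \sum_(e | 0 < mu e) mu e ^+ 2 = \sum_(e in Kedges n) mu e ^+ 2.
    rewrite big_mkcond [RHS]big_mkcond; apply: eq_bigr => e _.
    have [eK|eK] := boolP (e \in Kedges n).
      case: ltP => // me; have -> : mu e = 0 by apply: le_anti; rewrite me mu_ge0.
      by rewrite expr0n.
    by case: mu_epm => _ -> //; rewrite ltxx.
  have two0 : 2 != 0 :> R by rewrite pnatr_eq0.
  apply: (mulfI two0).
  rewrite -(sum_Kedges (fun e => mu e ^+ 2)) /q mulrA mulfV ?pnatr_eq0 // mul1r.
  by apply: eq_bigr => x _; rewrite [RHS](bigD1 x) //= Md expr0n add0r.
have q1 : q <= 1.
  have Mm1 : 2^-1 * \sum_x \sum_y M x y = 1 := Mm.
  rewrite -[leRHS]Mm1; apply: ler_wpM2l; first by rewrite invr_ge0.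
  apply: ler_sum => x _; apply: ler_sum => y _; rewrite expr2 ler_piMr //.
  exact: le_trans (deg_ge M0 x y) (deg_le1 M0 Ms Md Mm x).
have sd : \sum_x deg M x ^+ 2 <= 1 ^+ 2 + q.
  apply: sum_deg_sqr => // [|x y Mxy].
    have H : 2^-1 * \sum_x deg M x = 1 := Mm; lra.
  have yx : y \notin [:: x] by rewrite inE; apply: contraNneq Mxy => ->; rewrite Md.
  have := step_le_rest_mass M0 Ms Md yx; rewrite (rest_mass1 Ms Md Mm) deg_split //.
    by rewrite (Ms y x); lra.
  by rewrite inE in yx.
have : 2 * beta mu (P_edges 3) <= \sum_y deg M y ^+ 2 - 2 * q.
  apply: le_trans (P_beta_le 1) _.
  have -> : \sum_y deg M y ^+ 2 - 2 * q = \sum_x \sum_y M x y * (deg M y - M x y).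
    have -> : 2 * q = \sum_x \sum_y M x y ^+ 2 by rewrite /q; field.
    have -> : \sum_y deg M y ^+ 2 = \sum_x \sum_y M x y * deg M y.
      rewrite exchange_big; apply: eq_bigr => y _; rewrite -mulr_suml expr2.
      by congr (_ * _); apply: eq_bigr => x _; exact: Ms.
    rewrite -sumrB; apply: eq_bigr => x _; rewrite -sumrB; apply: eq_bigr => y _; ring.
  apply: ler_sum => x _; apply: ler_sum => y _.
  have -> : deg M y - M x y = \sum_(z | z != x) M y z.
    by rewrite (Ms x y) /deg (bigD1 x) //= addrC addrK.
  rewrite mulr_sumr [leRHS]big_mkcond /=.
  apply: ler_sum => z _; rewrite /pwl /= mulr1 !inE !andbT.
  have [->|zx] := eqVneq z x; first by rewrite ?eqxx ?orbT.
  by case: ifP => // _; rewrite mulr_ge0.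
lra.
Qed.

End BetaBounds.

(** * Extremal examples *)

Lemma single_edge_epm (R : realType) :
  is_epm ([ffun e => if e == [set: 'I_2]%SET then 1 else 0] : {ffun {set 'I_2} -> R}).
Proof.
have KE : Kedges 2 = [set [set: 'I_2]%SET].
  apply/finset.setP => e; rewrite !inE eqEcard finset.subsetT cardsT card_ord eqn_leq.
  by have := max_card e; rewrite card_ord => ->.
split=> [e|e|].
- by rewrite ffunE; case: ifP.
- by rewrite KE inE ffunE => /negPf ->.
- by rewrite KE big_set1 ffunE eqxx.
Qed.

Section UniformCycle.
Variables (R : realType) (k : nat).
Let m : R := k.+3%:R.
Let mu : {ffun {set 'I_k.+3} -> R} := [ffun e => if e \in C_edges k.+3 then m^-1 else 0].

Local Lemma m_gt0 : 0 < m. Proof. by rewrite ltr0n. Qed.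

Local Lemma card_C_edges : #|C_edges k.+3| = k.+3.
Proof. by rewrite C_edgesE card_imset ?card_ord //; exact: cycle_edge_inj. Qed.

Lemma uniform_cycle_epm : is_epm mu.
Proof.
have CK e : e \in C_edges k.+3 -> e \in Kedges k.+3.
  rewrite C_edgesE => /imsetP[i _ ->]; rewrite inE cards2.
  suff -> : i != ordS i by [].
  apply/eqP => /(congr1 (@nat_of_ord _)); rewrite val_ordS.
  by case: eqP; lia.
split=> [e|e eK|].
- by rewrite ffunE; case: ifP; rewrite // invr_ge0 ltW // m_gt0.
- by rewrite ffunE; case: ifP => // /CK; rewrite (negPf eK).
rewrite (big_setID (C_edges k.+3)) /= [X in _ + X]big1 ?addr0 => [|e]; last first.
  by rewrite inE ffunE => /andP[/negPf ->].
have -> : Kedges k.+3 :&: C_edges k.+3 = C_edges k.+3.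
  by apply/finset.setIidPr/fintype.subsetP => e /CK.
rewrite (eq_bigr (fun=> m^-1)) => [|e eC]; last by rewrite ffunE eC.
by rewrite sumr_const card_C_edges -mulr_natl mulfV // gt_eqF // m_gt0.
Qed.

(** The cycle itself is one copy, of weight [m^(-m)], and [2 m] times this is [2 / m^(m-1)]. *)
Lemma uniform_cycle_ge :
  2 / m ^+ k.+2 <= 2 * m * beta mu (C_edges k.+3) + beta mu (P_edges k.+4).
Proof.
have eM := uniform_cycle_epm.
have : m ^- k.+3 <= beta mu (C_edges k.+3).
  rewrite /beta (bigD1 ([set: 'I_k.+3]%SET, C_edges k.+3)) /=; last first.
    apply/existsP; exists [ffun i => i]; apply/and3P; split.
    - by apply/injectiveP => i j; rewrite !ffunE.
    - have -> : [ffun i => i] @: [set: 'I_k.+3]%SET = id @: [set: 'I_k.+3]%SET.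
        by apply: eq_imset => i; rewrite ffunE.
      by rewrite imset_id.
    - apply/eqP; rewrite -[LHS]imset_id; apply: eq_imset => e /=.
      by rewrite -[LHS]imset_id; apply: eq_imset => i; rewrite ffunE.
  rewrite -[leLHS]addr0; apply: lerD.
    rewrite /mu_sub (eq_bigr (fun=> m^-1)) => [|e eC]; last by rewrite ffunE eC.
    by rewrite prodr_const card_C_edges exprVn.
  by apply: sumr_ge0 => VF _; exact: mu_sub_ge0.
have := beta_ge0 eM (P_edges k.+4).
have m0 := m_gt0; have mn0 : 0 <= 2 * m by rewrite mulr_ge0 // ltW.
have -> : 2 / m ^+ k.+2 = 2 * m * m ^- k.+3.
  have cancel (a X : R) : a != 0 -> X != 0 -> 2 / X = 2 * a * (a * X)^-1.
    by move=> a0 X0; field; rewrite ?a0 ?X0.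
  by rewrite [m ^+ k.+3]exprS; apply: cancel; rewrite ?expf_neq0 // gt_eqF.
by move=> b0 /(ler_wpM2l mn0); lra.
Qed.

End UniformCycle.

(** * The three suprema *)

Theorem theorem1p6 (R : realType) :
  [/\ is_sup (fun x : R => exists n (mu : {ffun {set 'I_n} -> R}), is_epm mu /\
          x = 2 * (\sum_(e | 0 < mu e) mu e ^+ 2) + beta mu (P_edges 3))
        2,
      forall m : nat, (m = 3 \/ m = 4)%N ->
        is_sup (fun x : R => exists n (mu : {ffun {set 'I_n} -> R}), is_epm mu /\
          x = 2 * m%:R * beta mu (C_edges m) + beta mu (P_edges m.+1))
          (2 / (m%:R ^+ m.-1))
    & forall m : nat, (5 <= m)%N ->
        exists2 s : R, is_sup (fun x : R => exists n (mu : {ffun {set 'I_n} -> R}),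
              is_epm mu /\ x = 2 * m%:R * beta mu (C_edges m) + beta mu (P_edges m.+1)) s
          & s < (27 / 10) / (m%:R ^+ m.-1)].
Proof.
split.
- split=> [_ [n [mu [mu_epm ->]]]|eps e0]; first exact: square_path_beta_le.
  set mu : {ffun {set 'I_2} -> R} := [ffun e => if e == [set: 'I_2]%SET then 1 else 0].
  have mu_epm : is_epm mu by exact: single_edge_epm.
  exists (2 * (\sum_(e | 0 < mu e) mu e ^+ 2) + beta mu (P_edges 3));
    first by exists 2, mu.
  have b0 := beta_ge0 mu_epm (P_edges 3).
  have : 1 <= \sum_(e | 0 < mu e) mu e ^+ 2.
    rewrite (bigD1 [set: 'I_2]%SET) /= ?ffunE ?eqxx // expr1n lerDl.
    by apply: sumr_ge0 => e _; exact: sqr_ge0.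
  lra.
- move=> m m34; split=> [_ [n [mu [mu_epm ->]]]|eps e0].
    have eM := epm_edge_weight mu_epm.
    case: m34 => ->; apply: le_trans (cycle_path_beta_le mu_epm _) _.
      exact: walk_sum3.
    exact: walk_sum4.
  have [k ->] : exists k, m = k.+3 by case: m34 => ->; [exists 0%N|exists 1%N].
  eexists; first by eexists; eexists; split; [exact: uniform_cycle_epm|reflexivity].
  by apply: lt_le_trans (uniform_cycle_ge R k); rewrite ltrBlDr ltrDl.
move=> [|[|[|k]]] // _.
set S : R -> Prop := fun x => exists n (mu : {ffun {set 'I_n} -> R}), is_epm mu /\
  x = 2 * k.+3%:R * beta mu (C_edges k.+3) + beta mu (P_edges k.+4).
(* The room between 2.69 and 2.7 makes the inequality strict for the supremum itself. *)
pose b : R := (269 / 100) / k.+3%:R ^+ k.+2.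
have Sb x : S x -> x <= b.
  move=> [n [mu [mu_epm ->]]]; apply: le_trans (cycle_path_beta_le mu_epm k) _.
  exact: (walk_sum_large (epm_edge_weight mu_epm) k).
have S0 : exists x, S x.
  by eexists; eexists; eexists; split; [exact: (uniform_cycle_epm R k)|reflexivity].
have hS : has_sup (S : classical_sets.set R) by split=> //; exists b => x /Sb.
exists (sup S).
  split=> [x Sx|eps e0]; first exact: sup_upper_bound.
  exact: sup_adherent.
apply: (@le_lt_trans _ _ b); first by apply: ge_sup => // x /Sb.
rewrite /b ltr_pM2r ?invr_gt0 ?exprn_gt0 ?ltr0n //; lra.
Qed.
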